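(* Let $n\in\{1,2,3\}$, let $\nu_1,\dots,\nu_n>0$, let $K$ be a strictly concave kernel function which is strictly monotone, i.e. strictly decreasing on $[-1,0)$ and strictly increasing on $(0,1]$, and let $J:[0,1]\to\mathbb{R}\cup\{-\infty\}$ be an upper semicontinuous $n$-field function. Then intertwining of maxima holds: for any two different regular node systems $\mathbf{x},\mathbf{y}\in Y$ there are indices $i,j\in\{0,1,\dots,n\}$ such that $m_i(\mathbf{x})>m_i(\mathbf{y})$ and $m_j(\mathbf{x})<m_j(\mathbf{y})$. Moreover, there is a unique equioscillation point, i.e. a unique node system $\mathbf{w}\in\overline{S}$ for which $m_0(\mathbf{w})=m_1(\mathbf{w})=\dots=m_n(\mathbf{w})$.
   Context: Kernel functions: a kernel function is a function $K:(-1,0)\cup(0,1)\to\mathbb{R}$ that is concave on $(-1,0)$ and concave on $(0,1)$ and satisfies $\lim_{t\downarrow 0}K(t)=\lim_{t\uparrow 0}K(t)$ (the limits exist in $\mathbb{R}\cup\{-\infty\}$ by concavity; the value $-\infty$ is allowed but not required). It is extended to $K:[-1,1]\to\mathbb{R}\cup\{-\infty\}$ by $K(0):=\lim_{t\to0}K(t)$, $K(-1):=\lim_{t\downarrow-1}K(t)$, $K(1):=\lim_{t\uparrow1}K(t)$. $K$ is strictly concave if it is strictly concave on each of the intervals $(-1,0)$ and $(0,1)$. Field functions: for $n\in\mathbb{N}=\{1,2,\dots\}$, an $n$-field function is a function $J:[0,1]\to\mathbb{R}\cup\{-\infty\}$ that is bounded above and assumes finite values at more than $n$ different points, where the points $0$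 and $1$ are counted with weight $1/2$ and points of $(0,1)$ with weight $1$; i.e. with $D=\{t\in[0,1]:J(t)\neq-\infty\}$ one requires $|D\cap(0,1)|+\tfrac12|D\cap\{0,1\}|>n$. Node systems: $\overline{S}=\{\mathbf{y}=(y_1,\dots,y_n)\in[0,1]^n: 0\le y_1\le\dots\le y_n\le1\}$; elements of $\overline{S}$ are called node systems. For $\mathbf{y}\in\overline{S}$ put $y_0:=0$, $y_{n+1}:=1$. Sum of translates function: $F(\mathbf{y},t):=J(t)+\sum_{j=1}^n\nu_jK(t-y_j)\in\mathbb{R}\cup\{-\infty\}$ for $\mathbf{y}\in\overline{S}$, $t\in[0,1]$. Interval maxima: $m_j(\mathbf{y}):=\sup_{t\in[y_j,y_{j+1}]}F(\mathbf{y},t)\in\mathbb{R}\cup\{-\infty\}$ for $j=0,1,\dots,n$ (the interval $[y_j,y_{j+1}]$ may be a single point). Regular node systems: $Y:=\{\mathbf{y}\in\overline{S}: m_j(\mathbf{y})\neq-\infty\text{ for all }j=0,1,\dots,n\}$. *)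

(* Defs.v *)
From HB Require Import structures.
From mathcomp Require Export all_boot all_order all_algebra.
From mathcomp Require Export all_classical all_reals all_analysis.
Export Order.TTheory GRing.Theory Num.Theory.
Export numFieldNormedType.Exports.

Set Implicit Arguments.
Unset Strict Implicit.
Unset Printing Implicit Defensive.

Local Open Scope classical_set_scope.
Local Open Scope ring_scope.

Definition concave_on (R : realType) (D : set R) (f : R -> R) : Prop :=
  @convex_function R R^o D (fun x => - f x).

Definition strictly_concave_on (R : realType) (D : set R) (f : R -> R) : Prop :=
  forall x y t : R, D x -> D y -> x != y -> 0 < t < 1 ->
    t * f x + (1 - t) * f y < f (t * x + (1 - t) * y).

(* Only the values of [K] on (-1,0) and (0,1) are meaningful; values at other
   points are never used. *)
Definition kernel_function (R : realType) (K : R -> R) : Prop :=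
  [/\ concave_on `]-1, 0[ K,
      concave_on `]0, 1[ K &
      lim ((K t)%:E @[t --> 0^'+]) = lim ((K t)%:E @[t --> 0^'-])].

Definition strictly_concave_kernel (R : realType) (K : R -> R) : Prop :=
  strictly_concave_on `]-1, 0[ K /\ strictly_concave_on `]0, 1[ K.

(* The extension of a kernel function to [-1,1] by its limits at -1, 0, 1. *)
Definition kernel_ext (R : realType) (K : R -> R) (t : R) : \bar R :=
  if t == 0 then lim ((K s)%:E @[s --> 0^'])
  else if t == -1 then lim ((K s)%:E @[s --> (-1)^'+])
  else if t == 1 then lim ((K s)%:E @[s --> 1^'-])
  else (K t)%:E.

Definition strictly_monotone_kernel (R : realType) (K : R -> R) : Prop :=
  {in `[-1, 0[ &, forall s t : R,
      s < t -> (kernel_ext K t < kernel_ext K s)%E} /\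
  {in `]0, 1] &, forall s t : R,
      s < t -> (kernel_ext K s < kernel_ext K t)%E}.

Definition finite_domain (R : realType) (J : R -> \bar R) : set R :=
  [set t | t \in `[0, 1] /\ J t != -oo%E].

(* Only the values of [J] on [0,1] are meaningful; the bound by a real number
   excludes the value +oo there.  [@counting R R A] is the cardinality of [A], and
   is +oo when [A] is infinite. *)
Definition field_function (R : realType) (n : nat) (J : R -> \bar R) : Prop :=
  (exists M : R, {in `[0, 1], forall t : R, (J t <= M%:E)%E}) /\
  (n%:R%:E < @counting R R (finite_domain J `&` `]0%R, 1%R[)
             + (2^-1)%R%:E * @counting R R (finite_domain J `&` [set 0%R; 1%R]))%E.

(* Upper semicontinuity relative to [0,1]. *)
Definition usc_unit_interval (R : realType) (J : R -> \bar R) : Prop :=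
  @lower_semicontinuous (subspace (`[0, 1] : set R)) R (fun t => (- J t)%E).

(* y_1, ..., y_n is stored as a tuple, so that [tnth y j] is y_{j+1}. *)
Definition node_system (R : realType) (n : nat) (y : n.-tuple R) : bool :=
  path <=%R 0 (rcons y 1).

(* y_k for k = 0, ..., n+1, with y_0 = 0 and y_{n+1} = 1. *)
Definition node (R : realType) (n : nat) (y : n.-tuple R) (k : nat) : R :=
  nth 1 (0 :: y) k.

Definition sum_of_translates (R : realType) (n : nat) (nu : 'I_n -> R)
    (K : R -> R) (J : R -> \bar R) (y : n.-tuple R) (t : R) : \bar R :=
  (J t + \sum_(j < n) (nu j)%:E * kernel_ext K (t - tnth y j)%R)%E.

Definition interval_max (R : realType) (n : nat) (nu : 'I_n -> R)
    (K : R -> R) (J : R -> \bar R) (y : n.-tuple R) (j : 'I_n.+1) : \bar R :=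
  ereal_sup [set sum_of_translates nu K J y t | t in `[node y j, node y j.+1]].

Definition regular_node_system (R : realType) (n : nat) (nu : 'I_n -> R)
    (K : R -> R) (J : R -> \bar R) (y : n.-tuple R) : Prop :=
  node_system y /\ forall j : 'I_n.+1, interval_max nu K J y j != -oo%E.

Definition equioscillation_point (R : realType) (n : nat) (nu : 'I_n -> R)
    (K : R -> R) (J : R -> \bar R) (w : n.-tuple R) : Prop :=
  node_system w /\
  forall i j : 'I_n.+1, interval_max nu K J w i = interval_max nu K J w j.

(* Main.v *)
Require Import Defs.
From mathcomp Require Import finmap ring lra zify.

Set Implicit Arguments.
Unset Strict Implicit.
Unset Printing Implicit Defensive.

Local Open Scope classical_set_scope.
Local Open Scope ring_scope.

(** If nodes on one side of [t] move towards a common point [z] with weighted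
    total displacement away from [t] nonnegative, strict concavity makes
    [F(., t)] increase strictly: compare every term with the tangent at [z].
    For [n <= 3] the differences of two node systems change sign at most twice,
    and on a suitably chosen interval this comparison, with monotonicity for the
    remaining nodes, makes the maximum larger or smaller as desired.

    For the existence of an equioscillation point, minimize the global maximum of
    [F(w, .)] over the compact set of node systems. If some [m_i(w)] were smaller
    than the global maximum, moving the nodes at the two ends of [[w_i, w_{i+1}]]
    slightly apart, with balanced total displacement, would lower [F] strictly
    outside that interval while upper semicontinuity keeps it below the maximum
    inside. Uniqueness is immediate from intertwining. *)

(** * Kernels on one side of the singularity *)

Definition slope (R : realType) (g : R -> R) (a b : R) : R :=
  (g b - g a) / (b - a).

Section HalfKernel.
Context {R : realType}.
Implicit Types (h : R -> \bar R) (f g : R -> R).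

(* A kernel restricted to one side of its singularity, as a function of the
   distance to it. *)
Definition half_kernel h : Prop :=
  [/\ forall u v, 0 <= u -> u < v -> v <= 1 -> (h u < h v)%E,
      forall u, 0 < u -> u <= 1 -> h u \is a fin_num,
      forall z, 0 < z -> z <= 1 -> exists2 l : R, 0 <= l &
        forall u v, 0 <= u -> u <= 1 -> 0 <= v -> v <= 1 ->
          (u < v <= z) || (z <= v < u) -> (h u + (l * (v - u))%R%:E < h v)%E &
      forall a : R, (h 0%R < a%:E)%E -> exists2 u, 0 < u <= 1 & (h u < a%:E)%E].

(** Strict concavity cleared of denominators. The outer point may be 1, so the limit value at the
    end of the domain is covered too. *)
Definition three_point_concave g := forall a b c : R, 0 < a -> a < b -> b < c -> c <= 1 ->
  (c - b) * g a + (b - a) * g c < (c - a) * g b.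

Lemma slopeltl g a b c : three_point_concave g ->
  0 < a -> a < b -> b < c -> c <= 1 -> slope g a c < slope g a b.
Proof.
move=> cg a0 ab bc c1; have := cg _ _ _ a0 ab bc c1; rewrite /slope.
by rewrite ltr_pdivrMr ?subr_gt0 ?(lt_trans ab)// mulrAC ltr_pdivlMr ?subr_gt0//; lra.
Qed.

Lemma slopeltr g a b c : three_point_concave g ->
  0 < a -> a < b -> b < c -> c <= 1 -> slope g b c < slope g a c.
Proof.
move=> cg a0 ab bc c1; have := cg _ _ _ a0 ab bc c1; rewrite /slope.
by rewrite ltr_pdivrMr ?subr_gt0// mulrAC ltr_pdivlMr ?subr_gt0 ?(lt_trans ab)//; lra.
Qed.

Lemma slopelt g a b c : three_point_concave g ->
  0 < a -> a < b -> b < c -> c <= 1 -> slope g b c < slope g a b.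
Proof. by move=> cg a0 ab bc c1; exact: lt_trans (slopeltr _ _ ab _ _) (slopeltl _ _ _ bc _). Qed.

Lemma slopeE g a b : a != b -> slope g a b * (b - a) = g b - g a.
Proof. by move=> ab; rewrite /slope divfK// subr_eq0 eq_sym. Qed.

(** The slope is the left derivative at [z], an infimum of chord slopes, which also makes sense at
    [z = 1]. Chord slopes decrease strictly, so it lies strictly below every chord left of [z] and
    strictly above every chord right of [z]. *)
Lemma tangent_slope g z : three_point_concave g ->
  (forall u v : R, 0 < u -> u < v -> v <= 1 -> g u < g v) -> 0 < z -> z <= 1 ->
  exists2 l : R, 0 <= l & forall u v, 0 < u -> u <= 1 -> 0 < v -> v <= 1 ->
    (u < v <= z) || (z <= v < u) -> g u + l * (v - u) < g v.
Proof.
move=> cg mg z0 z1; pose S := [set slope g u z | u in `]0, z[].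
have S0 : S !=set0 by exists (slope g (z / 2) z); exists (z / 2) => //=; rewrite in_itv/=; lra.
have lbS : lbound S 0.
  move=> y [u /=]; rewrite in_itv/= => /andP[u0 uz] <-.
  by rewrite /slope divr_ge0// subr_ge0 ltW// mg.
have hS : has_inf S by split => //; exists 0.
(* Moving [u] halfway to [z] lowers the slope, so the infimum is not attained. *)
have infle u : 0 < u -> u < z -> inf S < slope g u z.
  move=> u0 uz; apply: (@le_lt_trans _ _ (slope g ((u + z) / 2) z)).
    by apply: ge_inf; [exact: hS.2|exists ((u + z) / 2) => //=; rewrite in_itv/=; lra].
  by apply: slopeltr => //; lra.
have leinf u : z < u -> u <= 1 -> slope g z u < inf S.
  move=> zu u1; apply: (@lt_le_trans _ _ (slope g z ((z + u) / 2))).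
    by apply: slopeltl => //; lra.
  apply: lb_le_inf => //; move=> y [s /=]; rewrite in_itv/= => /andP[s0 sz] <-.
  by apply/ltW/slopelt => //; lra.
exists (inf S); first exact: lb_le_inf.
move=> u v u0 u1 v0 v1 /orP[/andP[uv]|/andP[zv vu]].
- have uv0 : 0 < v - u by rewrite subr_gt0.
  rewrite -ltrBrDl -slopeE ?(lt_eqF uv)// ltr_pM2r//.
  rewrite le_eqVlt => /orP[/eqP vz|vz]; first by rewrite vz; apply: infle => //; lra.
  by apply: (@lt_trans _ _ (slope g v z)); [exact: infle|exact: slopelt].
- have uv0 : 0 < u - v by rewrite subr_gt0.
  suff : slope g v u * (u - v) < inf S * (u - v).
    by rewrite slopeE ?(lt_eqF vu)//; lra.
  rewrite ltr_pM2r//; move: zv; rewrite le_eqVlt => /orP[/eqP zv|zv]; first by rewrite -zv; apply: leinf => //; lra.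
  by apply: (@lt_trans _ _ (slope g z v)); [exact: slopelt|exact: leinf].
Qed.

Lemma strictly_concave_three_point f a b c : strictly_concave_on `]0, 1[ f ->
  0 < a -> a < b -> b < c -> c < 1 ->
  (c - b) * f a + (b - a) * f c < (c - a) * f b.
Proof.
move=> cf a0 ab bc c1; have ca : 0 < c - a by lra.
have ca0 : c - a != 0 by rewrite gt_eqF.
have := cf a c ((c - b) / (c - a)).
rewrite /= !in_itv/= a0 c1 (lt_trans (lt_trans ab bc) c1) (lt_trans (lt_trans a0 ab) bc).
move=> /(_ isT isT); rewrite (lt_eqF (lt_trans ab bc)) => /(_ isT).
have t01 : 0 < (c - b) / (c - a) < 1 by apply/andP; split; [apply: divr_gt0 => //; lra|rewrite ltr_pdivrMr//; lra].
move=> /(_ t01).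
have -> : (c - b) / (c - a) * a + (1 - (c - b) / (c - a)) * c = b by field.
rewrite -(ltr_pM2r ca) mulrDl => H.
by rewrite [ltRHS]mulrC; apply: le_lt_trans H; rewrite le_eqVlt; apply/orP; left; apply/eqP; field.
Qed.

(** By monotonicity the limits at the two ends are an infimum and a supremum. The content is that
    [h 1] is finite and that the strict inequalities survive the passage to 0 and 1. *)
Lemma half_kernel_extension f h :
  strictly_concave_on `]0, 1[ f ->
  (forall u v : R, 0 < u -> u < v -> v < 1 -> f u < f v) ->
  (forall u : R, 0 < u -> u < 1 -> h u = (f u)%:E) ->
  h 0 = ereal_inf [set (f s)%:E | s in `]0, 1[] ->
  h 1 = ereal_sup [set (f s)%:E | s in `]0, 1[] ->
  half_kernel h.
Proof.
move=> cf mf hf h0E h1E.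
have sup1 u : 0 < u -> u < 1 -> ((f u)%:E < h 1%R)%E.
  move=> u0 u1; apply: (@lt_le_trans _ _ (f ((u + 1) / 2))%:E).
    by rewrite lte_fin; apply: mf => //; lra.
  by rewrite h1E; apply: ereal_sup_ubound; exists ((u + 1) / 2) => //=; rewrite in_itv/=; lra.
(* The line through the graph at [b] and [c] bounds [f] beyond [c] by concavity; before [c],
   monotonicity bounds [f] by [f c]. *)
have le1 b c : 0 < b -> b < c -> c < 1 -> (h 1%R <= (f b + slope f b c * (1 - b))%R%:E)%E.
  move=> b0 bc c1; rewrite h1E; apply: ge_ereal_sup => _ [s /= + <-].
  rewrite in_itv/= => /andP[s0 s1]; rewrite lee_fin.
  have sl0 : 0 < slope f b c by rewrite /slope divr_gt0 ?subr_gt0 ?mf.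
  have bcE : slope f b c * (c - b) = f c - f b by rewrite slopeE ?lt_eqF.
  apply: (@le_trans _ _ (f b + slope f b c * (Num.max s c - b))); last first.
    by rewrite lerD2l ler_pM2l// lerD2r ge_max !ltW.
  have [sc|] := leP s c.
    rewrite bcE addrC subrK; move: sc; rewrite le_eqVlt => /orP[/eqP->//|sc].
    by rewrite ltW// mf.
  move=> cs; have := strictly_concave_three_point cf b0 bc cs s1.
  have -> : slope f b c = (f c - f b) / (c - b) by [].
  have cb : 0 < c - b by lra.
  move=> H; rewrite mulrAC -lerBlDl ler_pdivlMr//; lra.
have fin1 : h 1 \is a fin_num.
  rewrite fin_numE; apply/andP; split.
    by rewrite gt_eqF//; apply: le_lt_trans (leNye _) (sup1 2^-1 _ _); lra.
  by rewrite lt_eqF//; apply: le_lt_trans (le1 (1/3) (2/3) _ _ _) (ltry _); lra.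
pose g u := fine (h u).
have gf u : 0 < u -> u < 1 -> g u = f u by move=> u0 u1; rewrite /g hf.
have hg u : 0 < u -> u <= 1 -> h u = (g u)%:E.
  move=> u0; rewrite le_eqVlt => /orP[/eqP->|u1]; first by rewrite /g fineK.
  by rewrite gf// hf.
have mg u v : 0 < u -> u < v -> v <= 1 -> g u < g v.
  move=> u0 uv; rewrite le_eqVlt => /orP[/eqP v1|v1].
    by rewrite -lte_fin -!hg//; [rewrite hf; [rewrite v1 sup1|..]|..] => //; lra.
  by rewrite !gf ?mf//; lra.
have cg : three_point_concave g.
  move=> a b c a0 ab bc; rewrite le_eqVlt => /orP[/eqP c1|c1]; last first.
    rewrite !gf//; [|lra..]; exact: strictly_concave_three_point.
  rewrite c1 in bc *; rewrite (gf a) ?(gf b); [|lra..].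
  (* A passage to the limit [c = 1] would lose strictness. The strict inequality is used at the
     intermediate point [c'], and the weak bound [le1] extends the chord from [b] through [c'] up to
     1. *)
  pose c' := (b + 1) / 2.
  have := le1 b c' ltac:(lra) ltac:(rewrite /c'; lra) ltac:(rewrite /c'; lra).
  rewrite hg// lee_fin => H.
  have := @strictly_concave_three_point f a b c' cf a0 ab ltac:(rewrite /c'; lra) ltac:(rewrite /c'; lra).
  have bcE : slope f b c' * (c' - b) = f c' - f b by rewrite slopeE// lt_eqF// /c'; lra.
  have -> : f c' = f b + slope f b c' * (c' - b) by rewrite bcE; lra.
  have cb : 0 < c' - b by rewrite /c'; lra.
  move=> H2; have {}H2 : (b - a) * slope f b c' < f b - f a.
    by rewrite -(ltr_pM2r cb); move: H2; lra.
  have : (b - a) * g 1 <= (b - a) * (f b + slope f b c' * (1 - b)) by rewrite ler_pM2l; lra.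
  have : (b - a) * slope f b c' * (1 - b) < (f b - f a) * (1 - b) by rewrite ltr_pM2r; lra.
  lra.
have inf0 u : 0 < u -> u <= 1 -> (h 0%R <= (g u)%:E)%E.
  move=> u0 u1; apply: (@le_trans _ _ (g (u / 2))%:E).
    rewrite gf; [|lra..]; rewrite h0E; apply: ereal_inf_lbound.
    by exists (u / 2) => //=; rewrite in_itv/=; lra.
  by rewrite lee_fin ltW// mg//; lra.
have lt0 u : 0 < u -> u <= 1 -> (h 0%R < (g u)%:E)%E.
  move=> u0 u1; apply: (@le_lt_trans _ _ (g (u / 2))%:E); first by apply: inf0; lra.
  by rewrite lte_fin mg//; lra.
split.
- move=> u v; rewrite le_eqVlt => /orP[/eqP<-|u0] uv v1.
    by rewrite (hg v)// lt0.
  by rewrite !hg ?lte_fin ?mg//; lra.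
- by move=> u u0 u1; rewrite hg.
- move=> z z0 z1; have [l l0 H] := tangent_slope cg mg z0 z1; exists l => // u v.
  rewrite le_eqVlt => /orP[/eqP<-|u0] u1; last first.
    move=> v0 v1 uvz; have {}v0 : 0 < v by move: uvz => /orP[/andP[]|/andP[]]; lra.
    by rewrite !hg// lte_fin H.
  move=> _ v1 /orP[/andP[v0 vz]|/andP[zv v0]]; last by have := lt_trans (lt_le_trans z0 zv) v0; rewrite ltxx.
  rewrite (hg v)// subr0.
  (* For [u = 0], pass to a small [s > 0], as [h 0 <= g s]. The strict gap [d] of the tangent
     inequality between [v / 2] and [v] absorbs the error [l * s]. *)
  have := H (v / 2) v ltac:(lra) ltac:(lra) ltac:(lra) ltac:(lra) ltac:(lra).
  set d := g v - (g (v / 2) + l * (v - v / 2)) => dgt.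
  have d0 : 0 < d by rewrite /d; lra.
  pose s := Num.min (v / 4) (d / (2 * (l + 1))).
  have s0 : 0 < s by rewrite /s lt_min divr_gt0//= ?divr_gt0 ?mulr_gt0//; lra.
  have sv : s <= v / 4 by rewrite /s ge_min lexx.
  have sd : l * s <= d / 2.
    have : s <= d / (2 * (l + 1)) by rewrite /s ge_min lexx orbT.
    rewrite ler_pdivlMr ?mulr_gt0//; [nra|lra].
  apply: (@le_lt_trans _ _ (g s + l * v)%:E).
    by rewrite EFinD leeD2r// inf0//; lra.
  have := H s (v / 2) ltac:(lra) ltac:(lra) ltac:(lra) ltac:(lra) ltac:(lra).
  by rewrite lte_fin /d in d0 sd *; lra.
- move=> a; rewrite h0E => /ereal_inf_lt[_ [u /= + <-]] ua.
  rewrite in_itv/= => /andP[u0 u1]; exists u; first by rewrite u0 ltW.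
  by rewrite hf.
Qed.

End HalfKernel.

(** * Continuity of kernels, semicontinuity along filters, and attainment of minima *)

Section Semicontinuity.
Context {R : realType}.
Implicit Types (h k : R -> \bar R).

(** Left of [s] monotonicity suffices; right of [s] the tangent at [s] bounds the growth by
    [l * (u - s)]. At [s = 0] the last clause of [half_kernel] gives a point whose value is below
    the threshold. *)
Lemma half_kernel_near_lt h s (a : R) : half_kernel h -> 0 <= s -> s <= 1 ->
  (h s < a%:E)%E -> \forall u \near s, 0 <= u -> u <= 1 -> (h u < a%:E)%E.
Proof.
move=> [mh fh th h0]; rewrite le_eqVlt => /orP[/eqP<- _ ha|s0 s1 ha].
  have [u /andP[u0 u1] ua] := h0 _ ha; near=> v => v0 v1.
  have vu : v < u by near: v; exact: lt_nbhsl.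
  exact: lt_trans (mh _ _ v0 vu u1) ua.
have [l l0 H] := th s s0 s1; have := fh _ s0 s1; move: ha.
case hs: (h s) => [g| |] // ga _; rewrite lte_fin in ga.
near=> u => u0 u1; have [us|su|->] := ltgtP u s; last by rewrite hs.
  by apply: lt_trans (mh _ _ u0 us s1) _; rewrite hs.
have ud : u < s + (a - g) / (l + 1).
  by near: u; apply: lt_nbhsl; rewrite ltrDl divr_gt0//; lra.
have := H u s u0 u1 (ltW s0) s1; rewrite su lexx orbT => /(_ isT).
have := fh _ (lt_trans s0 su) u1; rewrite hs; case: (h u) => [r| |]// _.
rewrite -EFinD !lte_fin; move: ud; rewrite -ltrBlDl ltr_pdivlMr//; [nra|lra].
Unshelve. all: by end_near. Qed.

(** Here the delicate side is the left of [s]. The tangent at [s / 2] serves, since for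
    [s / 2 <= u < s] it bounds the drop of [h] by a multiple of [s - u]. *)
Lemma half_kernel_near_gt h s (a : R) : half_kernel h -> 0 <= s -> s <= 1 ->
  (a%:E < h s)%E -> \forall u \near s, 0 <= u -> u <= 1 -> (a%:E < h u)%E.
Proof.
move=> [mh fh th h0]; rewrite le_eqVlt => /orP[/eqP<- _ ha|s0 s1 ha].
  near=> v; rewrite le_eqVlt => /orP[/eqP<-//|v0] v1.
  exact: lt_trans ha (mh _ _ _ v0 v1).
have [l l0 H] := th (s / 2) ltac:(lra) ltac:(lra); have := fh _ s0 s1; move: ha.
case hs: (h s) => [g| |] // ga _; rewrite lte_fin in ga.
near=> u => u0 u1; have [us|su|->] := ltgtP u s; last by rewrite hs.
  have ud : s - (g - a) / (l + 1) < u.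
    by near: u; apply: lt_nbhsr; rewrite gtrBl divr_gt0//; lra.
  have u2 : s / 2 < u by near: u; apply: lt_nbhsr; lra.
  have := H s u (ltW s0) s1 u0 u1; rewrite us (ltW u2) orbT => /(_ isT).
  have := fh u ltac:(lra) u1; rewrite hs; case: (h u) => [r| |]// _.
  rewrite -EFinD !lte_fin; move: ud; rewrite ltrBlDr -ltrBlDl ltr_pdivlMr//; [nra|lra].
by apply: lt_trans (mh _ _ (ltW s0) su u1); rewrite hs.
Unshelve. all: by end_near. Qed.

Definition two_sided_kernel k := half_kernel k /\ half_kernel (k \o -%R).

Lemma two_sided_kernelN k : two_sided_kernel k -> two_sided_kernel (k \o -%R).
Proof.
by case=> kp kn; split=> //; rewrite [X in half_kernel X](_ : _ = k)//; apply/funext => x /=; rewrite opprK.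
Qed.

(** [p] stands for either strict comparison with a real number, so that the two halves are glued at
    0 only once. *)
Lemma two_sided_near (p : \bar R -> Prop) k s :
  (forall h, half_kernel h -> forall s, 0 <= s -> s <= 1 -> p (h s) ->
     \forall u \near s, 0 <= u -> u <= 1 -> p (h u)) ->
  two_sided_kernel k -> -1 <= s -> s <= 1 -> p (k s) ->
  \forall u \near s, -1 <= u -> u <= 1 -> p (k u).
Proof.
move=> hp [kp kn] s0 s1 ps.
have P1 : \forall u \near s, 0 <= u -> u <= 1 -> p (k u).
  have [s0'|s0'] := leP 0 s; first exact: hp.
  near=> u => u0; suff : u < 0 by rewrite ltNge u0.
  by near: u; exact: lt_nbhsl.
have P2 : \forall u \near s, u <= 0 -> -1 <= u -> p (k u).
  have [s0'|s0'] := leP s 0; last first.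
    near=> u => u0; suff : 0 < u by rewrite ltNge u0.
    by near: u; exact: lt_nbhsr.
  have := hp _ kn (- s); rewrite /= opprK => /(_ ltac:(lra) ltac:(lra) ps).
  rewrite nearN => H; apply: filterS H => u /= H u0 u1.
  by move: H; rewrite opprK; apply; lra.
near=> u => u0 u1; have [uge0|/ltW ule0] := leP 0 u.
  by move: uge0 u1; near: u.
by move: ule0 u0; near: u.
Unshelve. all: by end_near. Qed.

Lemma two_sided_near_lt k s (a : R) :
  two_sided_kernel k -> -1 <= s -> s <= 1 -> (k s < a%:E)%E ->
  \forall u \near s, -1 <= u -> u <= 1 -> (k u < a%:E)%E.
Proof.
apply: (@two_sided_near (fun l => (l < a%:E)%E)) => h hh t t0 t1.
exact: half_kernel_near_lt.
Qed.

Lemma two_sided_near_gt k s (a : R) :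
  two_sided_kernel k -> -1 <= s -> s <= 1 -> (a%:E < k s)%E ->
  \forall u \near s, -1 <= u -> u <= 1 -> (a%:E < k u)%E.
Proof.
apply: (@two_sided_near (fun l => (a%:E < l)%E)) => h hh t t0 t1.
exact: half_kernel_near_gt.
Qed.

(** An arbitrary filter lets the nodes and the evaluation point vary jointly, through a product
    filter, or separately. *)
Definition usc_along T (G : set_system T) (f : T -> \bar R) (l : \bar R) :=
  forall a : R, (l < a%:E)%E -> \forall x \near G, (f x < a%:E)%E.

Definition lsc_along T (G : set_system T) (f : T -> \bar R) (l : \bar R) :=
  forall a : R, (a%:E < l)%E -> \forall x \near G, (a%:E < f x)%E.

Lemma usc_alongD T (G : set_system T) (FG : Filter G) f g (l m : \bar R) :
  l != +oo%E -> m != +oo%E -> usc_along G f l -> usc_along G g m ->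
  usc_along G (fun x => f x + g x)%E (l + m)%E.
Proof.
move=> lp mp uf ug a lma.
(* Split the threshold [a]; a summand equal to -oo takes whatever share the other one leaves. *)
have [b [c [lb mc bc]]] : exists b c : R, [/\ l < b%:E, m < c%:E & (b + c <= a)%R]%E.
  move: lp mp lma; case: l {uf} => [l| |]//; case: m {ug} => [m| |]// _ _; rewrite ?lte_fin => H.
  - by exists (l + (a - (l + m)) / 2), (m + (a - (l + m)) / 2); rewrite !lte_fin; split; lra.
  - by exists (l + 1), (a - (l + 1)); rewrite ltNyr lte_fin; split => //; lra.
  - by exists (a - (m + 1)), (m + 1); rewrite ltNyr lte_fin; split => //; lra.
  - by exists a, 0; rewrite !ltNyr addr0.
apply: filterS2 (uf _ lb) (ug _ mc) => x fb gc.
by apply: lt_le_trans (lteD fb gc) _; rewrite -EFinD lee_fin.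
Qed.

Lemma lsc_alongD T (G : set_system T) (FG : Filter G) f g (l m : \bar R) :
  lsc_along G f l -> lsc_along G g m ->
  l != +oo%E -> m != +oo%E -> lsc_along G (fun x => f x + g x)%E (l + m)%E.
Proof.
move=> uf ug lp mp a lma.
have [b [c [lb mc bc]]] : exists b c : R, [/\ b%:E < l, c%:E < m & (a <= b + c)%R]%E.
  move: lp mp lma; case: l {uf} => [l| |]//; case: m {ug} => [m| |]// _ _; rewrite ?lte_fin => H.
  by exists (l + (a - (l + m)) / 2), (m + (a - (l + m)) / 2); rewrite !lte_fin; split; lra.
apply: filterS2 (uf _ lb) (ug _ mc) => x fb gc.
by apply: le_lt_trans (lteD fb gc); rewrite -EFinD lee_fin.
Qed.

Lemma usc_along_pmull T (G : set_system T) (FG : Filter G) f (l : \bar R) (c : R) :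
  0 < c -> usc_along G f l -> usc_along G (fun x => c%:E * f x)%E (c%:E * l)%E.
Proof.
move=> c0 uf a; rewrite -lte_pdivlMl// => /uf.
by apply: filterS => x; rewrite -lte_pdivlMl//.
Qed.

Lemma lsc_along_pmull T (G : set_system T) (FG : Filter G) f (l : \bar R) (c : R) :
  0 < c -> lsc_along G f l -> lsc_along G (fun x => c%:E * f x)%E (c%:E * l)%E.
Proof.
move=> c0 uf a; rewrite -lte_pdivrMl// => /uf.
by apply: filterS => x; rewrite -lte_pdivrMl//.
Qed.

Lemma sume_neq_pinfty n (f : 'I_n -> \bar R) :
  (forall j, f j != +oo%E) -> (\sum_j f j)%E != +oo%E.
Proof. by move=> H; elim/big_ind : _ => // x y; rewrite -!ltey; exact: lte_add_pinfty. Qed.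

Lemma usc_along_sum T (G : set_system T) (FG : Filter G) n (f : 'I_n -> T -> \bar R)
    (l : 'I_n -> \bar R) : (forall j, l j != +oo%E) ->
  (forall j, usc_along G (f j) (l j)) ->
  usc_along G (fun x => \sum_j f j x)%E (\sum_j l j)%E.
Proof.
elim: n f l => [|n IH] f l lp uf.
  rewrite big_ord0 => a a0; near=> x; by rewrite big_ord0.
rewrite big_ord_recl => a la.
have := @usc_alongD _ _ FG _ _ _ _ (lp ord0) (sume_neq_pinfty (fun j => lp (lift ord0 j)))
  (uf ord0) (IH (fun j => f (lift ord0 j)) (fun j => l (lift ord0 j)) (fun j => lp _) (fun j => uf _)).
by move=> /(_ a la); apply: filterS => x; rewrite big_ord_recl.
Unshelve. all: by end_near. Qed.

Lemma lsc_along_sum T (G : set_system T) (FG : Filter G) n (f : 'I_n -> T -> \bar R)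
    (l : 'I_n -> \bar R) : (forall j, l j != +oo%E) ->
  (forall j, lsc_along G (f j) (l j)) ->
  lsc_along G (fun x => \sum_j f j x)%E (\sum_j l j)%E.
Proof.
elim: n f l => [|n IH] f l lp uf.
  rewrite big_ord0 => a a0; near=> x; by rewrite big_ord0.
rewrite big_ord_recl => a la.
have := @lsc_alongD _ _ FG _ _ _ _ (uf ord0)
  (IH (fun j => f (lift ord0 j)) (fun j => l (lift ord0 j)) (fun j => lp _) (fun j => uf _))
  (lp ord0) (sume_neq_pinfty (fun j => lp (lift ord0 j))).
by move=> /(_ a la); apply: filterS => x; rewrite big_ord_recl.
Unshelve. all: by end_near. Qed.

Lemma compact_lsc_argmin (T : topologicalType) (A : set T) (f : T -> \bar R) :
  compact A -> A !=set0 ->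
  (forall x, A x -> forall a : R, (a%:E < f x)%E ->
     \forall y \near x, A y -> (a%:E < f y)%E) ->
  exists2 x, A x & forall y, A y -> (f x <= f y)%E.
Proof.
move=> /compact_near_coveringP/near_covering_withinP cA [x0 Ax0] lf.
(* Otherwise cover [A] along the filter of "eventually small values of [f]":
   each point of the filter would have to lie strictly below itself. *)
apply: contrapT => nomin.
pose G : set_system T := [set S | exists2 y, A y & forall y', A y' -> (f y' <= f y)%E -> S y'].
have FG : Filter G.
  split; first by exists x0.
  - move=> P Q [y Ay yP] [z Az zQ]; have [yz|zy] := leP (f y) (f z).
      by exists y => // u Au uy; split; [exact: yP|apply: zQ => //; exact: le_trans yz].
    by exists z => // u Au uz; split; [apply: yP => //; exact: le_trans (ltW zy)|exact: zQ].
  - by move=> P Q PQ [y Ay yP]; exists y => // u Au uy; exact/PQ/yP.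
have := cA _ G (fun y x => f y < f x)%E FG.
have H : forall x, A x -> \forall x' \near x & y \near G, A x' -> (f y < f x')%E.
  move=> x Ax; have [y Ay yx] : exists2 y, A y & (f y < f x)%E.
    apply: contrapT => ny; apply: nomin; exists x => // y Ay.
    by rewrite leNgt; apply/negP => yx; apply: ny; exists y.
  have [a ya ax] : exists2 a : R, (f y <= a%:E)%E & (a%:E < f x)%E.
    move: yx; case: (f y) => [r| |]; case: (f x) => [s| |]//.
    - by exists r.
    - by exists r.
    - by exists (s - 1); rewrite ?leNye// lte_fin; lra.
    - by exists 0; rewrite ?leNye ?ltry.
  exists ([set x' | A x' -> (a%:E < f x')%E], [set y' | (f y' <= f y)%E]).
    by split; [exact: lf|exists y].
  by case=> x' y' /= [h1 h2] Ax'; apply: le_lt_trans (h1 Ax'); exact: le_trans ya.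
move=> /(_ H) [y Ay /(_ y Ay (lexx _)) /(_ y Ay)].
by rewrite ltxx.
Qed.

End Semicontinuity.

(** * Comparison of sums of translates when nodes move *)

Section Translates.
Context {R : realType} {n : nat} (nu : 'I_n -> R).
Hypothesis nu_gt0 : forall j, 0 < nu j.
Implicit Types (k J : R -> \bar R) (x y : 'I_n -> R).

(** The nodes form an arbitrary function rather than an ordered tuple, since reflected and perturbed
    families of nodes occur as well. *)
Definition translate_sum k J x (t : R) : \bar R :=
  (J t + \sum_(j < n) (nu j)%:E * k (t - x j)%R)%E.

Lemma half_kernel_neq_pinfty (h : R -> \bar R) u :
  half_kernel h -> 0 <= u -> u <= 1 -> h u != +oo%E.
Proof.
move=> [mh fh _ _]; rewrite le_eqVlt => /orP[/eqP<- _|u0 u1].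
  by have := mh 0 1 (lexx _) ltr01 (lexx _); rewrite -ltey => /lt_le_trans; apply; exact: leey.
by have := fh _ u0 u1; rewrite fin_numE => /andP[].
Qed.

Lemma two_sided_neq_pinfty k u :
  two_sided_kernel k -> -1 <= u -> u <= 1 -> k u != +oo%E.
Proof.
move=> [kp kn] u0 u1; have [h|/ltW h] := leP 0 u; first exact: half_kernel_neq_pinfty.
by have := @half_kernel_neq_pinfty _ (- u) kn; rewrite /= opprK; apply; lra.
Qed.

Lemma two_sided_ninfty k u :
  two_sided_kernel k -> -1 <= u -> u <= 1 -> k u = -oo%E -> u = 0.
Proof.
move=> [[_ fp _ _] [_ fn _ _]] u0 u1 ku; have [h|h|//] := ltgtP u 0.
  by have := fn (- u); rewrite /= opprK ku => /(_ ltac:(lra) ltac:(lra)).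
by have := fp _ h u1; rewrite ku.
Qed.

(** The hypotheses force every term on both sides to be finite, so the comparison takes place in the
    reals. *)
Lemma ler_sume_shift (a b : 'I_n -> \bar R) (c : 'I_n -> R) :
  (forall j, a j != +oo%E) -> (forall j, b j != +oo%E) -> (0 <= \sum_j c j)%R ->
  (forall j, a j + (c j)%:E <= b j)%E ->
  (\sum_j a j)%E != -oo%E -> (exists j, a j + (c j)%:E < b j)%E ->
  (\sum_j a j < \sum_j b j)%E.
Proof.
move=> ap bp c0 H sa [j0 Hj0].
have fa j : a j \is a fin_num.
  rewrite fin_numE ap andbT; apply: contra sa => /eqP aj.
  by rewrite (bigD1 j)//= aj addNye// sume_neq_pinfty.
have fb j : b j \is a fin_num.
  rewrite fin_numE bp andbT -ltNye; apply: lt_le_trans (H j).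
  by rewrite -(fineK (fa j)) -EFinD ltNyr.
have {}H j : fine (a j) + c j <= fine (b j).
  by rewrite -lee_fin EFinD !fineK.
have {}Hj0 : fine (a j0) + c j0 < fine (b j0).
  by rewrite -lte_fin EFinD !fineK.
under eq_bigr do rewrite -(fineK (fa _)).
under [X in (_ < X)%E]eq_bigr do rewrite -(fineK (fb _)).
rewrite !sumEFin lte_fin; apply: (@le_lt_trans _ _ (\sum_j (fine (a j) + c j))).
  by rewrite big_split/= lerDl.
by rewrite (bigD1 j0)//= [ltRHS](bigD1 j0)//= ltr_leD// ler_sum.
Qed.

(* The nodes in [P] move towards [z] without crossing it, so by concavity each
   term with such a node gains more than the displacement times the slope [l] of
   the kernel at distance [z - t]; the balance condition sums these to [>= 0]. *)
Lemma translate_sum_lt_right k J x y t z (P : pred 'I_n) :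
  two_sided_kernel k -> J t != +oo%E ->
  (forall j, `|t - x j| <= 1) -> (forall j, `|t - y j| <= 1) -> z - t <= 1 ->
  (forall j, ~~ P j -> (t <= x j <= y j) || (y j <= x j <= t)) ->
  (forall j, P j -> [/\ t <= x j, t <= y j & (x j <= y j <= z) || (z <= y j <= x j)]) ->
  0 <= \sum_(j | P j) nu j * (y j - x j) ->
  (exists j, x j != y j) -> translate_sum k J x t != -oo%E ->
  (translate_sum k J x t < translate_sum k J y t)%E.
Proof.
move=> kk Jt xt yt zt nP HP sP [j0 xyj0] Fx.
have [kp kn] := kk.
have [l l0 Hl] : exists2 l : R, 0 <= l & forall j, P j -> x j != y j ->
    (k (t - x j)%R + (l * (y j - x j))%R%:E < k (t - y j)%R)%E.
  have [tz|zt'] := ltP t z.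
    have [_ _ /(_ (z - t) ltac:(lra) zt)[l l0 H] _] := kn.
    exists l => // j /HP[tx ty xyz] xy.
    have := H (x j - t) (y j - t); rewrite /= !opprB.
    have -> : y j - t + (t - x j) = y j - x j by lra.
    have := xt j; have := yt j; rewrite !ler_norml => /andP[? ?] /andP[? ?].
    apply; [lra..|].
    rewrite !ltrD2r !lerD2r; move: xy xyz; rewrite neq_lt => /orP[xy|xy].
      by rewrite xy (ltW xy) [y j <= x j]leNgt xy /= andbF orbF => ->.
    by rewrite xy (ltW xy) [x j <= y j]leNgt xy /= andbT => ->; rewrite orbT.
  (* When [z <= t], a node of [P] that moves can only move left, so the balance condition keeps them
     all in place and the claim is vacuous. *)
  exists 0 => // j Pj xyj; exfalso.
  have cle j' : P j' -> 0 <= nu j' * (x j' - y j').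
    move=> /HP[tx ty xyz]; apply: mulr_ge0; first exact: ltW.
    by move: xyz => /orP[/andP[]|/andP[]]; lra.
  have : \sum_(j | P j) nu j * (x j - y j) = 0.
    apply/eqP; rewrite eq_le sumr_ge0// andbT -oppr_ge0 -sumrN.
    by under eq_bigr do rewrite -mulrN opprB.
  move/psumr_eq0P => /(_ cle j Pj) /eqP; rewrite mulf_eq0 (gt_eqF (nu_gt0 j))/=.
  by rewrite subr_eq0 (negbTE xyj).
(* Guaranteed gain of each term: the tangent part for nodes in [P], and 0 for the others, whose
   distance to [t] does not shrink. *)
pose c j := if P j then nu j * (l * (y j - x j)) else 0.
have xk j : ((nu j)%:E * k (t - x j)%R)%E != +oo%E.
  have := xt j; rewrite ler_norml => /andP[? ?].
  have := @two_sided_neq_pinfty k (t - x j) kk; move=> /(_ ltac:(lra) ltac:(lra)).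
  by case: (k _) => [r| |]// _; rewrite gt0_muleNy ?lte_fin.
have yk j : ((nu j)%:E * k (t - y j)%R)%E != +oo%E.
  have := yt j; rewrite ler_norml => /andP[? ?].
  have := @two_sided_neq_pinfty k (t - y j) kk; move=> /(_ ltac:(lra) ltac:(lra)).
  by case: (k _) => [r| |]// _; rewrite gt0_muleNy ?lte_fin.
have lt_c j : x j != y j -> ((nu j)%:E * k (t - x j)%R + (c j)%:E < (nu j)%:E * k (t - y j)%R)%E.
  move=> xy; rewrite /c; case: ifPn => Pj.
    by rewrite EFinM -muleDr ?fin_num_adde_defl// lte_pmul2l// ?lte_fin// Hl.
  rewrite adde0 lte_pmul2l// ?lte_fin//.
  have := xt j; have := yt j; rewrite !ler_norml => /andP[? ?] /andP[? ?].
  have [/andP[tx xy']|/andP[yx xt']] := orP (nP _ Pj).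
    have [mh _ _ _] := kn; have := mh (x j - t) (y j - t); rewrite /= !opprB.
    by move: xy'; rewrite le_eqVlt (negbTE xy)/= => xy'; apply; lra.
  have [mh _ _ _] := kp; apply: mh; [lra| |lra].
  by move: yx; rewrite le_eqVlt eq_sym (negbTE xy)/=; lra.
rewrite /translate_sum; move: Fx; rewrite /translate_sum => Fx.
have : (\sum_(j < n) (nu j)%:E * k (t - x j)%R < \sum_(j < n) (nu j)%:E * k (t - y j)%R)%E.
  apply: (@ler_sume_shift _ _ c) => //.
  - rewrite /c -big_mkcond/=; under eq_bigr do rewrite mulrCA.
    by rewrite -mulr_sumr mulr_ge0.
  - move=> j; have [xy|/lt_c/ltW//] := eqVneq (x j) (y j).
    by rewrite /c xy subrr !mulr0 if_same adde0.
  - by apply: contraNneq Fx => ->; rewrite addeNy.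
  - by exists j0; exact: lt_c.
rewrite lteD2lE// fin_numE Jt andbT.
apply: contraNneq Fx => ->; rewrite addNye//; exact: sume_neq_pinfty.
Qed.

(** Mirror image of [translate_sum_lt_right]: reflect the kernel, the field, the nodes and the point
    at 0. *)
Lemma translate_sum_lt_left k J x y t z (P : pred 'I_n) :
  two_sided_kernel k -> J t != +oo%E ->
  (forall j, `|t - x j| <= 1) -> (forall j, `|t - y j| <= 1) -> t - z <= 1 ->
  (forall j, ~~ P j -> (t <= x j <= y j) || (y j <= x j <= t)) ->
  (forall j, P j -> [/\ x j <= t, y j <= t & (z <= y j <= x j) || (x j <= y j <= z)]) ->
  0 <= \sum_(j | P j) nu j * (x j - y j) ->
  (exists j, x j != y j) -> translate_sum k J x t != -oo%E ->
  (translate_sum k J x t < translate_sum k J y t)%E.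
Proof.
move=> kk Jt xt yt zt nP HP sP xy Fx.
have E w : translate_sum k J w t =
    translate_sum (k \o -%R) (J \o -%R) (fun j => - w j) (- t).
  rewrite /translate_sum /= opprK; congr (_ + _)%E; apply: eq_bigr => j _.
  by rewrite !opprD !opprK.
rewrite !E; apply: (@translate_sum_lt_right _ _ _ _ _ (- z) P).
- exact: two_sided_kernelN.
- by rewrite /= opprK.
- by move=> j; rewrite -normrN opprB opprK addrC.
- by move=> j; rewrite -normrN opprB opprK addrC.
- lra.
- by move=> j /nP; rewrite !lerN2 orbC => /orP[/andP[-> ->]|/andP[-> ->]]; rewrite ?orbT.
- by move=> j /HP[? ? /orP[/andP[? ?]|/andP[? ?]]]; rewrite !lerN2; split=> //; apply/orP; [left|right]; apply/andP.
- by under eq_bigr do rewrite opprK addrC.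
- by have [j xyj] := xy; exists j; rewrite eqr_opp.
- by rewrite -E.
Qed.

End Translates.

(** * From kernel functions to two-sided kernels *)

Section KernelExt.
Context {R : realType}.
Implicit Types K f : R -> R.

Lemma cvg_at_right_inf f (a b : R) : a < b ->
  (forall u v, a < u -> u < v -> v < b -> f u < f v) ->
  (f t)%:E @[t --> a^'+] --> ereal_inf [set (f s)%:E | s in `]a, b[].
Proof.
move=> ab mf; apply: (nondecreasing_at_right_cvge (BLeft b)); first by rewrite bnd_simp.
move=> u v; rewrite !in_itv/= => /andP[au ub] /andP[av vb].
by rewrite le_eqVlt => /orP[/eqP->//|uv]; rewrite lee_fin ltW// mf.
Qed.

Lemma cvg_at_left_sup f (a b : R) : a < b ->
  (forall u v, a < u -> u < v -> v < b -> f u < f v) ->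
  (f t)%:E @[t --> b^'-] --> ereal_sup [set (f s)%:E | s in `]a, b[].
Proof.
move=> ab mf; apply/cvg_at_leftNP.
have -> : [set (f s)%:E | s in `]a, b[] = [set (f (- s))%:E | s in `]- b, - a[].
  apply/seteqP; split => _ [s /= + <-]; rewrite in_itv/= => /andP[h1 h2].
    by exists (- s); rewrite ?opprK//= in_itv/= !ltrN2 h1 h2.
  by exists (- s) => //=; rewrite in_itv/=; apply/andP; split; lra.
apply: (nonincreasing_at_right_cvge (BLeft (- a))); first by rewrite bnd_simp ltrN2.
move=> u v; rewrite !in_itv/= => /andP[au ub] /andP[av vb].
by rewrite le_eqVlt => /orP[/eqP->//|uv]; rewrite lee_fin ltW// mf//; lra.
Qed.

Lemma cvg_dnbhs_sides (T : topologicalType) (g : R -> T) (p : R) (l : T) :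
  g x @[x --> p^'+] --> l -> g x @[x --> p^'-] --> l -> g x @[x --> p^'] --> l.
Proof.
move=> gr gl A nA; have {}gr : \forall x \near p, p < x -> A (g x) := gr _ nA.
have {}gl : \forall x \near p, x < p -> A (g x) := gl _ nA.
suff : \forall x \near p, x != p -> A (g x) by [].
by apply: filterS2 gr gl => x xr xl; rewrite neq_lt => /orP[/xl|/xr].
Qed.

Lemma strictly_concave_onN K :
  strictly_concave_on `]-1, 0[ K -> strictly_concave_on `]0, 1[ (K \o -%R).
Proof.
move=> cK x y t; rewrite /= !in_itv/= => /andP[x0 x1] /andP[y0 y1] xy t01.
have := cK (- x) (- y) t; rewrite /= !in_itv/= eqr_opp.
have -> : t * - x + (1 - t) * - y = - (t * x + (1 - t) * y) by lra.
by apply => //; apply/andP; split; lra.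
Qed.

(** Strict monotonicity turns the limits that define [kernel_ext] into the infima and suprema asked
    for by [half_kernel_extension], applied to [K] and to its reflection. *)
Lemma two_sided_kernel_ext K : kernel_function K -> strictly_concave_kernel K ->
  strictly_monotone_kernel K -> two_sided_kernel (kernel_ext K).
Proof.
move=> [_ _ lim0] [cn cp] [mn mp].
have extK u : -1 < u -> u < 1 -> u != 0 -> kernel_ext K u = (K u)%:E.
  move=> u0 u1 un; rewrite /kernel_ext (negbTE un) (gt_eqF u0) (lt_eqF u1).
  by [].
have ext0 : kernel_ext K 0 = lim ((K s)%:E @[s --> 0^']) by rewrite /kernel_ext eqxx.
have N10 : -1 == 0 :> R = false by apply/eqP; lra.
have N11 : 1 == -1 :> R = false by apply/eqP; lra.
have ext1 : kernel_ext K 1 = lim ((K s)%:E @[s --> 1^'-]).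
  by rewrite /kernel_ext oner_eq0 N11 eqxx.
have extN1 : kernel_ext K (-1) = lim ((K s)%:E @[s --> (-1)^'+]).
  by rewrite /kernel_ext N10 eqxx.
have mKp u v : 0 < u -> u < v -> v < 1 -> K u < K v.
  move=> u0 uv v1; rewrite -lte_fin -!extK; [|lra|lra|by rewrite gt_eqF//; lra|lra|lra|by rewrite gt_eqF//; lra].
  by apply: mp => //; rewrite in_itv/=; apply/andP; split; lra.
have mKn u v : 0 < u -> u < v -> v < 1 -> (K \o -%R) u < (K \o -%R) v.
  move=> u0 uv v1 /=; rewrite -lte_fin -!extK; [|lra|lra|by rewrite lt_eqF//; lra|lra|lra|by rewrite lt_eqF//; lra].
  by apply: mn; rewrite ?in_itv/=; first [apply/andP; split; lra|lra].
have c0p := cvg_at_right_inf (@ltr01 R) mKp.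
have c1p := cvg_at_left_sup (@ltr01 R) mKp.
have c0n : (K t)%:E @[t --> 0^'-] --> ereal_inf [set ((K \o -%R) s)%:E | s in `]0, 1[].
  by apply/cvg_at_leftNP; rewrite oppr0; exact: (cvg_at_right_inf (@ltr01 R) mKn).
have c1n : (K t)%:E @[t --> (-1)^'+] --> ereal_sup [set ((K \o -%R) s)%:E | s in `]0, 1[].
  by apply/cvg_at_rightNP; rewrite opprK; exact: (cvg_at_left_sup (@ltr01 R) mKn).
(* Both one-sided limits at 0 are infima; the kernel condition says that they agree, which yields
   the two-sided limit and one common value for both halves. *)
move: lim0; rewrite (cvg_lim _ c0p)// (cvg_lim _ c0n)// => inf0.
have c0 : (K t)%:E @[t --> 0^'] --> ereal_inf [set (K s)%:E | s in `]0, 1[].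
  by apply: cvg_dnbhs_sides => //; rewrite inf0.
split.
- apply: (@half_kernel_extension _ K) => //.
  + by move=> u u0 u1; rewrite extK ?gt_eqF//; lra.
  + by rewrite ext0; exact: cvg_lim.
  + by rewrite ext1; exact: cvg_lim.
- apply: (@half_kernel_extension _ (K \o -%R)) => //.
  + exact: strictly_concave_onN.
  + by move=> u u0 u1 /=; rewrite extK// ?oppr_eq0 ?gt_eqF//; lra.
  + by rewrite /= oppr0 ext0 -inf0; exact: cvg_lim.
  + by rewrite /= extN1; exact: cvg_lim.
Qed.

End KernelExt.

(** * Ordered nodes and their intervals *)

Section Nodes.
Context {R : realType} {n : nat}.
Implicit Types y : n.-tuple R.

Lemma tnth_node y (j : 'I_n) : tnth y j = node y j.+1.
Proof. by rewrite (tnth_nth 1). Qed.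

Lemma node0 y : node y 0 = 0. Proof. by []. Qed.

Lemma node_last y : node y n.+1 = 1.
Proof. by rewrite /node /= nth_default ?size_tuple. Qed.

Lemma node_le y i j : node_system y -> (i <= j)%N -> (j <= n.+1)%N ->
  node y i <= node y j.
Proof.
(* The default value 1 in [node] coincides with the appended right end point, so [node] reads the
   sorted list [0 :: rcons y 1]. *)
move=> sy ij jn; have nthE l : node y l = nth 1 (0 :: rcons y 1) l.
  case: l => [//|l] /=; rewrite /node /= nth_rcons; case: ltnP => // yl.
  by rewrite nth_default// if_same.
rewrite !nthE; apply: (@sorted_leq_nth _ <=%R le_trans lexx 1 (0 :: rcons y 1) sy) => //;
  by rewrite inE /= size_rcons size_tuple ltnS// (leq_trans ij).
Qed.

Lemma node_itv y i : node_system y -> (i <= n.+1)%N -> 0 <= node y i <= 1.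
Proof.
move=> sy iN; rewrite -{1}(node0 y) -(node_last y) !node_le//.
Qed.

Lemma tnth_itv y (j : 'I_n) : node_system y -> 0 <= tnth y j <= 1.
Proof. by move=> sy; rewrite tnth_node node_itv// ltnS ltnW. Qed.

Lemma exists_node_itv y t : node_system y -> 0 <= t <= 1 ->
  exists i : 'I_n.+1, t \in `[node y i, node y i.+1].
Proof.
move=> sy /andP[t0 t1]; pose p i := (i <= n)%N && (node y i <= t).
have ex : exists i, p i by exists 0%N.
have pn i : p i -> (i <= n)%N by case/andP.
have [i /andP[iN it] imax] := ex_maxnP ex pn.
exists (Ordinal (iN : (i < n.+1)%N)); rewrite in_itv/= it/=.
move: iN; rewrite leq_eqVlt => /orP[/eqP ->|iN]; first by rewrite node_last.
rewrite leNgt; apply/negP => /ltW h.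
by have := imax i.+1; rewrite /p h iN => /(_ isT); rewrite ltnn.
Qed.

Lemma node_system_tuple (w : 'I_n -> R) : (forall j, 0 <= w j <= 1) ->
  (forall i j : 'I_n, (i <= j)%N -> w i <= w j) ->
  node_system [tuple w j | j < n].
Proof.
move=> w01 wle; rewrite /node_system rcons_path path_sortedE; last exact: le_trans.
apply/andP; split; [apply/andP; split|].
- by apply/allP => _ /tnthP[j ->]; rewrite tnth_mktuple; case/andP: (w01 j).
- apply/(sortedP 1) => i; rewrite size_tuple => iN.
  have iN' := ltnW iN.
  rewrite -(tnth_nth 1 _ (Ordinal iN)) -(tnth_nth 1 _ (Ordinal iN')) !tnth_mktuple.
  exact: wle.
- have := mem_last 0 [tuple w j | j < n]; rewrite inE => /orP[/eqP->//|].
  by case/tnthP => j ->; rewrite tnth_mktuple; case/andP: (w01 j).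
Qed.

End Nodes.

(** * Semicontinuity of the sum of translates and attainment of interval maxima *)

Section Maxima.
Context {R : realType} {n : nat} (nu : 'I_n -> R) (k J : R -> \bar R).
Hypothesis nu_gt0 : forall j, 0 < nu j.
Hypothesis kk : two_sided_kernel k.
Hypothesis J_neq_pinfty : forall t, 0 <= t <= 1 -> J t != +oo%E.
Hypothesis J_usc : forall t, 0 <= t <= 1 -> forall a : R, (J t < a%:E)%E ->
  \forall s \near t, 0 <= s <= 1 -> (J s < a%:E)%E.

Local Notation F := (translate_sum nu k J).

Lemma weighted_neq_pinfty j u : -1 <= u -> u <= 1 -> ((nu j)%:E * k u)%E != +oo%E.
Proof.
move=> u0 u1; have := two_sided_neq_pinfty kk u0 u1.
by case: (k _) => [r| |]// _; rewrite gt0_muleNy ?lte_fin.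
Qed.

(** The kernel terms are continuous in the extended sense, and the field is upper semicontinuous, so
    the nodes and the point may move together. *)
Lemma translate_sum_usc_along T (G : set_system T) (FG : Filter G)
    (X : T -> 'I_n -> R) (tau : T -> R) (w : 'I_n -> R) (t : R) :
  (forall j, X p j @[p --> G] --> w j) -> tau p @[p --> G] --> t ->
  (\forall p \near G, 0 <= tau p <= 1) ->
  (\forall p \near G, forall j, 0 <= X p j <= 1) ->
  0 <= t <= 1 -> (forall j, 0 <= w j <= 1) ->
  usc_along G (fun p => F (X p) (tau p)) (F w t).
Proof.
move=> Xw taut tau01 X01 t01 w01.
have d01 j : -1 <= t - w j /\ t - w j <= 1 by have := w01 j; split; lra.
apply: usc_alongD; first exact: J_neq_pinfty.
- by apply: sume_neq_pinfty => j; apply: weighted_neq_pinfty; apply d01.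
- move=> a /(J_usc t01) /taut Ja.
  by apply: filterS2 tau01 Ja => p /[swap]; apply.
- apply: usc_along_sum.
    by move=> j; apply: weighted_neq_pinfty; apply d01.
  move=> j; apply: usc_along_pmull => // a ka.
  have := two_sided_near_lt kk (proj1 (d01 j)) (proj2 (d01 j)) ka.
  have tw : tau p - X p j @[p --> G] --> t - w j by exact: cvgB.
  move=> /tw H; apply: (@filterS3 _ G FG _ _ _ _ _ H tau01 X01) => p /= {}H p01 /(_ j) pj.
  by apply: H; lra.
Qed.

(** With [t] fixed the field contributes a constant, so lower semicontinuity in the nodes comes from
    the kernel. *)
Lemma translate_sum_lsc_along T (G : set_system T) (FG : Filter G)
    (X : T -> 'I_n -> R) (w : 'I_n -> R) (t : R) :
  (forall j, X p j @[p --> G] --> w j) ->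
  (\forall p \near G, forall j, 0 <= X p j <= 1) ->
  0 <= t <= 1 -> (forall j, 0 <= w j <= 1) ->
  lsc_along G (fun p => F (X p) t) (F w t).
Proof.
move=> Xw X01 t01 w01.
have d01 j : -1 <= t - w j /\ t - w j <= 1 by have := w01 j; split; lra.
apply: lsc_alongD.
- by move=> a Ja; near=> p.
- apply: lsc_along_sum.
    by move=> j; apply: weighted_neq_pinfty; apply d01.
  move=> j; apply: lsc_along_pmull => // a ka.
  have := two_sided_near_gt kk (proj1 (d01 j)) (proj2 (d01 j)) ka.
  have tw : t - X p j @[p --> G] --> t - w j by apply: cvgB => //; exact: cvg_cst.
  move=> /tw H; apply: (@filterS2 _ G FG _ _ _ _ H X01) => p /= {}H /(_ j) pj.
  by apply: H; lra.
- exact: J_neq_pinfty.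
- by apply: sume_neq_pinfty => j; apply: weighted_neq_pinfty; apply d01.
Unshelve. all: by end_near. Qed.

(** Attainment is what turns pointwise strict inequalities into strict inequalities between
    suprema. *)
Lemma translate_sum_argmax (w : 'I_n -> R) a b : 0 <= a -> a <= b -> b <= 1 ->
  (forall j, 0 <= w j <= 1) ->
  exists2 t, t \in `[a, b] & ereal_sup [set F w s | s in `[a, b]] = F w t.
Proof.
move=> a0 ab b1 w01.
have [||t tab tmax] := @compact_lsc_argmin R R `[a, b]%classic (fun t => - F w t)%E (segment_compact (a:=a) (b:=b)).
- by exists a; rewrite /= in_itv/= lexx.
- move=> t; rewrite /= in_itv/= => /andP[t0 t1] c; rewrite lteNr -EFinN => Fc.
  have t01 : 0 <= t <= 1 by lra.
  have := @translate_sum_usc_along R (within `[a, b]%classic (nbhs t)) _ (fun _ => w) id w t _ _ _ _ t01 w01 _ Fc.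
  move=> H; have {}H : \forall s \near within `[a, b]%classic (nbhs t), (F w s < (- c)%:E)%E.
    apply: H; [by move=> j; exact: cvg_cst|exact: cvg_within| |exact: nearW].
    apply: filterS (withinT _ (nbhs_filter t)) => s /=.
    by rewrite in_itv/= => /andP[s0 s1]; lra.
  by move: H; rewrite near_withinE; apply: filterS => s /= + sab => /(_ sab); rewrite lteNr.
exists t => //; apply/eqP; rewrite eq_le; apply/andP; split.
  by apply: ge_ereal_sup => _ [s /= sab <-]; rewrite -leeN2; exact: tmax.
by apply: ereal_sup_ubound; exists t.
Qed.

Definition interval_sup (y : n.-tuple R) i : \bar R :=
  ereal_sup [set F (tnth y) t | t in `[node y i, node y i.+1]].

(** Evaluate at a maximizer for [x]: it stays in the larger interval of [y], and the strict gain
    there survives. *)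
Lemma interval_sup_lt x y i : node_system x -> node_system y -> (i <= n)%N ->
  node y i <= node x i -> node x i.+1 <= node y i.+1 ->
  interval_sup x i != -oo%E ->
  (forall t, node x i <= t <= node x i.+1 -> F (tnth x) t != -oo%E ->
     (F (tnth x) t < F (tnth y) t)%E) ->
  (interval_sup x i < interval_sup y i)%E.
Proof.
move=> sx sy iN yx1 yx2 mx H.
have /andP[a0 _] := node_itv sx (leqW iN).
have /andP[_ b1] := node_itv sx (iN : (i.+1 <= n.+1)%N).
have [t] := translate_sum_argmax a0 (node_le sx (leqnSn i) iN) b1 (fun j => tnth_itv j sx).
rewrite -/(interval_sup x i) in_itv/= => tI mxt.
rewrite mxt in mx *; apply: lt_le_trans (H _ tI mx) _.
by apply: ereal_sup_ubound; exists t => //=; rewrite in_itv/=; lra.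
Qed.

(** * Intertwining: sign patterns of the difference of two node systems *)

Definition zigzag p q (x y : n.-tuple R) := forall j : 'I_n,
  [/\ (j < p)%N -> tnth x j <= tnth y j,
      (p <= j < q)%N -> tnth y j <= tnth x j &
      (q <= j)%N -> tnth x j <= tnth y j].

Lemma dist_le1 (s t : R) : 0 <= s <= 1 -> 0 <= t <= 1 -> `|s - t| <= 1.
Proof. by move=> hs ht; rewrite ler_norml; lra. Qed.

(** From [x] to [y] the first two blocks move towards [node y p]. If their weighted displacement is
    nonnegative, the sum grows left of all nodes, on interval 0; otherwise it grows on interval [q],
    just after these blocks. The third block moves right, away from both intervals. *)
Lemma zigzag_gain p q x y : node_system x -> node_system y ->
  (0 < p)%N -> (p <= q <= n)%N -> (p < q)%N || (p == n) ->
  zigzag p q x y -> (exists j, tnth x j != tnth y j) ->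
  (forall i, (i <= n)%N -> interval_sup x i != -oo%E) ->
  exists2 i, (i <= n)%N & (interval_sup x i < interval_sup y i)%E.
Proof.
move=> sx sy p0 /andP[pq qn] pqn zz xy mx.
have x01 j := tnth_itv j sx; have y01 j := tnth_itv j sy.
have xdist (t : R) j : 0 <= t <= 1 -> `|t - tnth x j| <= 1 by move=> ?; exact: dist_le1.
have ydist (t : R) j : 0 <= t <= 1 -> `|t - tnth y j| <= 1 by move=> ?; exact: dist_le1.
have z01 := node_itv sy (leq_trans pq (leqW qn)).
(* [tnth] counts from 0 and [node] from 1, so [node y p] is the last node of the first block. *)
have yp_ge (j : 'I_n) : (j < p)%N -> tnth y j <= node y p.
  by move=> jp; rewrite tnth_node node_le// leqW// (leq_trans pq).
have yp_le (j : 'I_n) : (p <= j)%N -> node y p <= tnth y j.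
  by move=> jp; rewrite tnth_node node_le// ltnW// ltnS.
have n0 : (0 < n)%N by exact: leq_trans p0 (leq_trans pq qn).
have [S0|S0] := leP 0 (\sum_(j < n | (j < q)%N) nu j * (tnth y j - tnth x j)).
- exists 0%N => //; apply: interval_sup_lt => //; rewrite ?node0//; [|exact: mx|].
    by rewrite -!(tnth_node _ (Ordinal n0)); have [+ _ _] := zz (Ordinal n0); apply.
  move=> t /andP[t0 tx].
  have txj j : t <= tnth x j.
    by apply: le_trans tx _; rewrite tnth_node node_le// ltnW// ltnS.
  have t01 : 0 <= t <= 1.
    by have := x01 (Ordinal n0); have := txj (Ordinal n0); lra.
  apply: (@translate_sum_lt_right _ _ _ _ _ _ _ _ _ (node y p) (fun j : 'I_n => j < q)%N) => //.
  + exact: J_neq_pinfty.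
  + by move=> j; exact: xdist.
  + by move=> j; exact: ydist.
  + lra.
  + by move=> j; rewrite -leqNgt => qj; have [_ _ /(_ qj) h] := zz j; rewrite txj h.
  + move=> j jq; have [h1 h2 _] := zz j; have [jp|pj] := ltnP j p.
      by rewrite h1// yp_ge//=; split=> //; exact: le_trans (txj j) (h1 jp).
    have {}h2 := h2 (introT andP (conj pj jq)).
    rewrite h2 yp_le// orbT; split => //; apply: le_trans (yp_le _ pj).
    have h : (p.-1 < n)%N by rewrite prednK// (leq_trans pq).
    rewrite -(prednK p0) -(tnth_node _ (Ordinal h)).
    by have [h' _ _] := zz (Ordinal h); apply: le_trans (txj _) (h' _); rewrite /= prednK.
(* A negative balance requires a leftward move, so the middle block is nonempty and the left end of
   interval [q] does not move right. *)
- have pltq : (p < q)%N.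
    move: pqn => /orP[//|/eqP pn]; have qE : q = p by apply/eqP; rewrite eqn_leq pq pn qn.
    move: S0; rewrite ltNge sumr_ge0// => j jq; apply: mulr_ge0; first exact: ltW.
    by rewrite subr_ge0; have [+ _ _] := zz j; apply; rewrite -qE.
  have q0 : (0 < q)%N by exact: leq_trans pq.
  have h : (q.-1 < n)%N by rewrite prednK.
  have yxq : node y q <= node x q.
    rewrite -(prednK q0) -!(tnth_node _ (Ordinal h)).
    have [_ + _] := zz (Ordinal h); apply; rewrite /= ?ltn_predL//.
    by rewrite -ltnS prednK// pltq q0.
  exists q => //; apply: interval_sup_lt => //; [|exact: mx|].
    move: qn; rewrite leq_eqVlt => /orP[/eqP->|qn]; first by rewrite !node_last.
    rewrite -!(tnth_node _ (Ordinal qn)).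
    by have [_ _ +] := zz (Ordinal qn); apply.
  move=> t /andP[xt tx].
  have xjt (j : 'I_n) : (j < q)%N -> tnth x j <= t.
    by move=> jq; apply: le_trans xt; rewrite tnth_node node_le// leqW.
  have yjt (j : 'I_n) : (j < q)%N -> tnth y j <= t.
    by move=> jq; apply: le_trans xt; apply: le_trans yxq; rewrite tnth_node node_le// leqW.
  have t01 : 0 <= t <= 1.
    by have := node_itv sx (leqW qn); have := node_itv sx (qn : (q.+1 <= n.+1)%N); lra.
  apply: (@translate_sum_lt_left _ _ _ _ _ _ _ _ _ (node y p) (fun j : 'I_n => j < q)%N) => //.
  + exact: J_neq_pinfty.
  + by move=> j; exact: xdist.
  + by move=> j; exact: ydist.
  + lra.
  + move=> j; rewrite -leqNgt => qj; have [_ _ /(_ qj) h'] := zz j; rewrite h' andbT.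
    by rewrite (le_trans tx)// tnth_node node_le// ltnW// ltnS.
  + move=> j jq; have [h1 h2 _] := zz j; split; [exact: xjt|exact: yjt|].
    have [jp|pj] := ltnP j p; first by rewrite h1// yp_ge// orbT.
    by rewrite h2 ?pj// yp_le.
  + rewrite -oppr_le0 -sumrN; under eq_bigr do rewrite -mulrN opprB.
    exact: ltW.
Qed.

(** Going back from [y] to [x], the last two blocks move towards [node x q], the last node of the
    middle block. The sign of their weighted displacement selects interval [p], just before them, or
    interval [n], right of all nodes. The first block moves left, away from both intervals. *)
Lemma zigzag_loss p q x y : node_system x -> node_system y ->
  (0 < p)%N -> (p <= q <= n)%N -> (p < q)%N || (p == n) ->
  zigzag p q x y -> (exists j, tnth x j != tnth y j) ->
  (forall i, (i <= n)%N -> interval_sup y i != -oo%E) ->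
  exists2 i, (i <= n)%N & (interval_sup y i < interval_sup x i)%E.
Proof.
move=> sx sy p0 /andP[pq qn] pqn zz [j0 xy0] my.
have yx : exists j, tnth y j != tnth x j by exists j0; rewrite eq_sym.
have x01 j := tnth_itv j sx; have y01 j := tnth_itv j sy.
have xdist (t : R) j : 0 <= t <= 1 -> `|t - tnth x j| <= 1 by move=> ?; exact: dist_le1.
have ydist (t : R) j : 0 <= t <= 1 -> `|t - tnth y j| <= 1 by move=> ?; exact: dist_le1.
have z01 := node_itv sx (leqW qn).
have xq_ge (j : 'I_n) : (j < q)%N -> tnth x j <= node x q.
  by move=> jq; rewrite tnth_node node_le// leqW.
have xq_le (j : 'I_n) : (q <= j)%N -> node x q <= tnth x j.
  by move=> jp; rewrite tnth_node node_le// ltnW// ltnS.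
have pn := leq_trans pq qn.
have [S0|S0] := leP 0 (\sum_(j < n | (p <= j)%N) nu j * (tnth x j - tnth y j)).
- have h : (p.-1 < n)%N by rewrite prednK.
  have yxp : node y p.+1 <= node x p.+1.
    move: pqn => /orP[pltq|/eqP->]; last by rewrite !node_last.
    have pn' := leq_trans pltq qn; rewrite -!(tnth_node _ (Ordinal pn')).
    by have [_ + _] := zz (Ordinal pn'); apply; rewrite /= leqnn.
  exists p => //; apply: interval_sup_lt => //; [|exact: my|].
    rewrite -(prednK p0) -!(tnth_node _ (Ordinal h)).
    by have [+ _ _] := zz (Ordinal h); apply; rewrite /= prednK.
  move=> t /andP[yt ty].
  have tyj (j : 'I_n) : (p <= j)%N -> t <= tnth y j.
    by move=> pj; apply: le_trans ty _; rewrite tnth_node node_le// ltnW// ltnS.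
  have txj (j : 'I_n) : (p <= j)%N -> t <= tnth x j.
    move=> pj; apply: le_trans ty _; apply: le_trans yxp _.
    by rewrite tnth_node node_le// ltnW// ltnS.
  have t01 : 0 <= t <= 1.
    by have := node_itv sy (leqW pn); have := node_itv sy (pn : (p.+1 <= n.+1)%N); lra.
  apply: (@translate_sum_lt_right _ _ _ _ _ _ _ _ _ (node x q) (fun j : 'I_n => p <= j)%N) => //.
  + exact: J_neq_pinfty.
  + by move=> j; exact: ydist.
  + by move=> j; exact: xdist.
  + lra.
  + move=> j; rewrite -ltnNge => jp; have [/(_ jp) h' _ _] := zz j.
    by rewrite h' (le_trans _ yt) ?orbT// tnth_node node_le// leqW.
  + move=> j pj; have [_ h2 h3] := zz j; split; [exact: tyj|exact: txj|].
    have [jq|qj] := ltnP j q; first by rewrite h2 ?pj// xq_ge.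
    by rewrite h3// xq_le// orbT.
(* A negative balance requires a leftward move from [y] to [x], so the third block is nonempty and
   the last node does not move right. *)
- have qltn : (q < n)%N.
    move: (qn); rewrite leq_eqVlt => /orP[/eqP qE|//].
    move: S0; rewrite ltNge sumr_ge0// => j pj; apply: mulr_ge0; first exact: ltW.
    by rewrite subr_ge0; have [_ + _] := zz j; apply; rewrite pj qE ltn_ord.
  have n0 : (0 < n)%N by exact: leq_trans qltn.
  have h : (n.-1 < n)%N by rewrite prednK.
  have xyn : node x n <= node y n.
    have nE (w : n.-tuple R) : node w n = tnth w (Ordinal h) by rewrite tnth_node /= prednK.
    by rewrite !nE; have [_ _ +] := zz (Ordinal h); apply; rewrite /= -ltnS prednK.
  exists n => //; apply: interval_sup_lt => //; [by rewrite !node_last|exact: my|].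
  move=> t /andP[yt t1].
  have yjt j : tnth y j <= t.
    by apply: le_trans yt; rewrite tnth_node node_le.
  have xjt j : tnth x j <= t.
    by apply: le_trans yt; apply: le_trans xyn; rewrite tnth_node node_le.
  have t01 : 0 <= t <= 1.
    by rewrite node_last in t1; rewrite t1 andbT; have := y01 j0; have := yjt j0; lra.
  apply: (@translate_sum_lt_left _ _ _ _ _ _ _ _ _ (node x q) (fun j : 'I_n => p <= j)%N) => //.
  + exact: J_neq_pinfty.
  + by move=> j; exact: ydist.
  + by move=> j; exact: xdist.
  + lra.
  + by move=> j; rewrite -ltnNge => jp; have [/(_ jp) h' _ _] := zz j; rewrite h' yjt orbT.
  + move=> j pj; have [_ h2 h3] := zz j; split=> //.
    have [jq|qj] := ltnP j q; first by rewrite h2 ?pj// xq_ge// orbT.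
    by rewrite h3// xq_le.
  + rewrite -oppr_le0 -sumrN; under eq_bigr do rewrite -mulrN opprB.
    exact: ltW.
Qed.

(* Up to exchanging [x] and [y]; four nodes would allow a pattern with three
   sign changes, for which the two lemmas above say nothing. *)
Lemma exists_zigzag x y (n0 : (0 < n)%N) : (n <= 3)%N ->
  tnth x (Ordinal n0) <= tnth y (Ordinal n0) ->
  exists p q, [/\ (0 < p)%N, (p <= q <= n)%N, (p < q)%N || (p == n) & zigzag p q x y].
Proof.
move=> n3 xy0; pose L i := node x i.+1 <= node y i.+1; pose G i := node y i.+1 <= node x i.+1.
have LG i : L i \/ G i by apply/orP; exact: le_total.
have L0 : L 0%N by move: xy0; rewrite !tnth_node.
suff [p [q [p0 pqn pq zz]]] : exists p q, [/\ (0 < p)%N, (p <= q <= n)%N, (p < q)%N || (p == n) &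
   forall j, (j < n)%N -> [/\ (j < p)%N -> L j, (p <= j < q)%N -> G j & (q <= j)%N -> L j]].
  by exists p, q; split => // j; rewrite !tnth_node; exact: zz.
have [n1|[n2|n3']] : n = 1%N \/ n = 2%N \/ n = 3%N by lia.
- by exists 1%N, 1%N; rewrite n1; split => // -[|]//; split => //.
- have [L1|G1] := LG 1%N.
    by exists 2%N, 2%N; rewrite n2; split => // -[|[|]]//; split => //.
  by exists 1%N, 2%N; rewrite n2; split => // -[|[|]]//; split => //.
- have [L1|G1] := LG 1%N; have [L2|G2] := LG 2%N.
  + by exists 3%N, 3%N; rewrite n3'; split => // -[|[|[|]]]//; split => //.
  + by exists 2%N, 3%N; rewrite n3'; split => // -[|[|[|]]]//; split => //.
  + by exists 1%N, 2%N; rewrite n3'; split => // -[|[|[|]]]//; split => //.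
  + by exists 1%N, 3%N; rewrite n3'; split => // -[|[|[|]]]//; split => //.
Qed.

Lemma intertwining x y : (1 <= n <= 3)%N -> node_system x -> node_system y ->
  (forall i, (i <= n)%N -> interval_sup x i != -oo%E) ->
  (forall i, (i <= n)%N -> interval_sup y i != -oo%E) -> x <> y ->
  exists i j, [/\ (i <= n)%N, (j <= n)%N,
    (interval_sup y i < interval_sup x i)%E & (interval_sup x j < interval_sup y j)%E].
Proof.
move=> /andP[n0 n3]; wlog xy0 : x y / tnth x (Ordinal n0) <= tnth y (Ordinal n0).
  move=> H sx sy mx my xy; have [h|h] := orP (le_total (tnth x (Ordinal n0)) (tnth y (Ordinal n0))).
    exact: H.
  have [i [j [iN jN h1 h2]]] := H _ _ h sy sx my mx (nesym xy).
  by exists j, i.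
move=> sx sy mx my xy; have [p [q [p0 pqn pq zz]]] := exists_zigzag n3 xy0.
have {}xy : exists j, tnth x j != tnth y j.
  apply: contrapT => H; apply: xy; apply: eq_from_tnth => j.
  by apply/eqP/negPn/negP => h; apply: H; exists j.
have [i iN h1] := zigzag_loss sx sy p0 pqn pq zz xy my.
have [j jN h2] := zigzag_gain sx sy p0 pqn pq zz xy mx.
by exists i, j.
Qed.

(** * Minimizing the global maximum *)

Definition total_sup (w : 'I_n -> R) : \bar R :=
  ereal_sup [set F w t | t in `[0, 1]].

(** Row vectors carry the product topology in which compactness is available. *)
Definition ordered_nodes : set 'rV[R]_n :=
  [set v | (forall j, 0 <= v ord0 j <= 1) /\
           forall i j : 'I_n, (i <= j)%N -> v ord0 i <= v ord0 j].

Lemma ordered_nodes_compact : compact ordered_nodes.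
Proof.
have cc : compact [set v : 'rV[R]_n | forall j, `[0, 1]%classic (v ord0 j)].
  by apply: (@rV_compact R n (fun=> `[0, 1]%classic)) => _; exact: segment_compact.
apply: (subclosed_compact _ cc); last first.
  by move=> v [v01 _] j; rewrite /= in_itv/=.
have -> : ordered_nodes = [set v : 'rV[R]_n | forall j, 0 <= v ord0 j <= 1] `&`
    \bigcap_(p in [set p : 'I_n * 'I_n | (p.1 <= p.2)%N]) [set v : 'rV[R]_n | v ord0 p.1 <= v ord0 p.2].
  apply/seteqP; split => v [v01 vle]; split => //.
    by case=> i j; exact: vle.
  by move=> i j ij; exact: (vle (i, j)).
apply: closedI.
  have -> : [set v : 'rV[R]_n | forall j, 0 <= v ord0 j <= 1] =
      \bigcap_(j in setT) ((fun v : 'rV[R]_n => v ord0 j) @^-1` `[0, 1]%classic).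
    apply/seteqP; split => v H j; first by move=> _; rewrite /= in_itv/=.
    by have := H j I; rewrite /= in_itv.
  apply: closed_bigI => j _; apply: closed_comp; last exact: itv_closed.
  by move=> v _; exact: coord_continuous.
apply: closed_bigI => -[i j] _ /=.
have -> : [set v : 'rV[R]_n | v ord0 i <= v ord0 j] =
    (fun v : 'rV[R]_n => v ord0 j - v ord0 i) @^-1` [set x | 0 <= x].
  by apply/seteqP; split => v /=; rewrite subr_ge0.
apply: closed_comp; last exact: closed_ge.
move=> v _; have H l := @coord_continuous R 1 n ord0 l v.
exact: (@cvgB R R _ (nbhs v) _ (fun v : 'rV[R]_n => v ord0 j) (fun v => v ord0 i) _ _ (H j) (H i)).
Qed.

(** For each fixed [t] the sum is lower semicontinuous in the nodes, hence so is the supremum over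
    [t], which attains its minimum on a compact set. *)
Lemma exists_total_sup_min : exists2 w : n.-tuple R, node_system w &
  forall y : n.-tuple R, node_system y -> (total_sup (tnth w) <= total_sup (tnth y))%E.
Proof.
have [||v [v01 vle] vmin] := @compact_lsc_argmin R _ ordered_nodes
    (fun v => total_sup (fun j => v ord0 j)) ordered_nodes_compact.
- by exists 0; split => [j|i j _]; rewrite !mxE// lexx ler01.
- move=> v [v01 _] a /ereal_sup_gt[_ [t /= + <-]]; rewrite in_itv/= => t01 Ft.
  have := @translate_sum_lsc_along _ (within ordered_nodes (nbhs v)) _
    (fun (v : 'rV[R]_n) j => v ord0 j) (fun j => v ord0 j) t.
  move=> H; have {}H : \forall u \near within ordered_nodes (nbhs v), (a%:E < F (fun j => (u : 'rV[R]_n) ord0 j) t)%E.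
    apply: H => //.
      move=> j; have cj := @coord_continuous R 1 n ord0 j v.
      by apply: cvg_trans cj; apply: cvg_app; exact: cvg_within.
    by apply: filterS (withinT _ (nbhs_filter v)) => u [].
  move: H; rewrite near_withinE; apply: filterS => u /= + ou => /(_ ou) H.
  apply: lt_le_trans H _; apply: ereal_sup_ubound; exists t => //=; by rewrite in_itv.
have wE : tnth [tuple v ord0 j | j < n] = (fun j => v ord0 j).
  by apply/funext => j; rewrite tnth_mktuple.
exists [tuple v ord0 j | j < n]; first exact: node_system_tuple.
move=> y sy; rewrite wE.
have yE : tnth y = (fun j => (\row_j tnth y j) ord0 j) by apply/funext => j; rewrite mxE.
rewrite yE; apply: vmin; split => [j|i j ij]; rewrite !mxE; first exact: tnth_itv.
by rewrite !tnth_node node_le// ?ltnS// ltnW// ltnS.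
Qed.

Lemma near_right0_mul_lt (c d : R) : 0 < d -> \forall e \near 0^'+, e * c < d.
Proof.
move=> d0; near=> e; have e0 : 0 < e by near: e; exact: nbhs_right_gt.
have ed : e < d / (`|c| + 1) by near: e; apply: nbhs_right_lt; rewrite divr_gt0// ltr_wpDl.
apply: le_lt_trans (_ : e * `|c| < d); first by rewrite ler_pM2l// ler_norm.
by move: ed; rewrite ltr_pdivlMr ?ltr_wpDl//; have := normr_ge0 c; nra.
Unshelve. all: by end_near. Qed.

(** * Spreading the nodes at the ends of one interval *)

Section Perturbation.
Variables (w : n.-tuple R) (i : nat) (sw : node_system w) (iN : (i <= n)%N).

Let a := node w i.
Let b := node w i.+1.
(** All nodes at the same end point and on the same side by index move together, to preserve the
    order. When [a = b] the index alone splits the coinciding nodes. *)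
Let toleft (j : 'I_n) := [&& (j < i)%N, tnth w j == a & 0 < a].
Let toright (j : 'I_n) := [&& (i <= j)%N, tnth w j == b & b < 1].
Let wl := \sum_(j | toleft j) nu j.
Let wr := \sum_(j | toright j) nu j.
Let dl := if b < 1 then wr else 1.
Let dr := if 0 < a then wl else 1.

(* The clusters at the two ends of the [i]-th interval move apart; the speeds
   balance the two total weights, unless one cluster is stuck at 0 or 1. *)
Definition spread_dir (j : 'I_n) : R :=
  if toleft j then - dl else if toright j then dr else 0.

Definition spread (e : R) (j : 'I_n) : R := tnth w j + e * spread_dir j.

Let aE : 0 < a -> exists j, toleft j.
Proof.
move=> a0; have i0 : (0 < i)%N by rewrite lt0n; apply: contraTneq a0; rewrite /a => ->; rewrite ltxx.
have h : (i.-1 < n)%N by rewrite prednK.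
by exists (Ordinal h); rewrite /toleft a0 tnth_node /= prednK// eqxx leqnn.
Qed.

Let bE : b < 1 -> exists j, toright j.
Proof.
move=> b1; have h : (i < n)%N.
  by rewrite ltn_neqAle iN andbT; apply: contraTneq b1; rewrite /b => ->; rewrite node_last ltxx.
by exists (Ordinal h); rewrite /toright b1 tnth_node /= leqnn eqxx.
Qed.

Let sum_gt0 (P : pred 'I_n) : (exists j, P j) -> 0 < \sum_(j | P j) nu j.
Proof.
move=> [j Pj]; rewrite (bigD1 j)//= ltr_wpDr//; apply: sumr_ge0 => l _; exact: ltW.
Qed.

Let dl_gt0 : 0 < dl. Proof. by rewrite /dl; case: ifPn => // /bE; exact: sum_gt0. Qed.
Let dr_gt0 : 0 < dr. Proof. by rewrite /dr; case: ifPn => // /aE; exact: sum_gt0. Qed.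

Let ab : a <= b. Proof. by rewrite /a /b node_le. Qed.

Let left_not_right j : toleft j -> toright j = false.
Proof. by case/and3P => ji _ _; rewrite /toright leqNgt ji. Qed.

Let dirE j : spread_dir j = (if toleft j then - dl else 0) + (if toright j then dr else 0).
Proof.
by rewrite /spread_dir; case: ifPn => [/left_not_right->|_]; rewrite ?addr0 ?add0r.
Qed.

Let dir_sum : \sum_(j | spread_dir j != 0) nu j * spread_dir j = wr * dr - wl * dl.
Proof.
rewrite big_mkcond/= (eq_bigr (fun j => nu j * spread_dir j)); last first.
  by move=> j _; case: eqP => //= ->; rewrite mulr0.
under eq_bigr do rewrite dirE mulrDr.
rewrite big_split/= addrC; congr (_ + _).
  by rewrite /wr mulr_suml [RHS]big_mkcond/=; apply: eq_bigr => j _; case: ifP; rewrite ?mulr0.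
rewrite /wl mulr_suml -sumrN [RHS]big_mkcond/=; apply: eq_bigr => j _.
by case: ifP; rewrite ?mulr0 ?mulrN.
Qed.

(** If both clusters move, the speeds cancel exactly. If [b = 1], only the left cluster moves, and
    the total is negative. *)
Let dir_sum_le0 : 0 < a -> \sum_(j | spread_dir j != 0) nu j * spread_dir j <= 0.
Proof.
move=> a0; rewrite dir_sum /dr a0 /dl; case: ifPn => b1; first by rewrite mulrC subrr.
rewrite /wr big_pred0; first by rewrite mul0r mulr1 add0r oppr_le0; exact/ltW/sum_gt0/aE.
by move=> j; rewrite /toright (negbTE b1) !andbF.
Qed.

Let dir_sum_ge0 : b < 1 -> 0 <= \sum_(j | spread_dir j != 0) nu j * spread_dir j.
Proof.
move=> b1; rewrite dir_sum /dl b1 /dr; case: ifPn => a0; first by rewrite mulrC subrr.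
rewrite /wl big_pred0; first by rewrite mul0r mulr1 subr0; exact/ltW/sum_gt0/bE.
by move=> j; rewrite /toleft (negbTE a0) !andbF.
Qed.

Let dirP j : [\/ [/\ toleft j, tnth w j = a, 0 < a & spread_dir j = - dl],
   [/\ toright j, tnth w j = b, b < 1 & spread_dir j = dr] | spread_dir j = 0].
Proof.
rewrite /spread_dir; case: ifPn => [h|_]; first by constructor 1; case/and3P: (h) => _ /eqP.
by case: ifPn => [h|_]; [constructor 2; case/and3P: (h) => _ /eqP|constructor 3].
Qed.

(** Strict gaps persist for small [e]. Among coinciding nodes the velocity is nondecreasing in the
    index: left cluster, then resting nodes, then right cluster. *)
Lemma spread_ordered : \forall e \near 0^'+, forall j l : 'I_n, (j <= l)%N ->
  spread e j <= spread e l.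
Proof.
apply: filter_forall => j; apply: filter_forall => l.
have [jl|lj] := leqP j l; last by apply: nearW => e.
have : tnth w j <= tnth w l by rewrite !tnth_node node_le// ?ltnS// ltnW// ltnS.
rewrite le_eqVlt => /orP[/eqP jlE|]; last first.
  rewrite -subr_gt0 => /(near_right0_mul_lt (spread_dir j - spread_dir l)).
  by apply: filterS => e; rewrite /spread => h _; lra.
near=> e => _; have e0 : 0 < e by near: e; exact: nbhs_right_gt.
rewrite /spread jlE lerD2l ler_pM2l//.
have [[/and3P[_ _ _] _ _ ->]|[/and3P[ij /eqP jb b1] _ _ jE]|jE] := dirP j.
- have := dl_gt0; have := dr_gt0.
  by have [[_ _ _ ->]|[_ _ _ ->]|->] := dirP l; lra.
- rewrite jE /spread_dir /toleft ltnNge (leq_trans ij jl)/=.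
  by rewrite /toright (leq_trans ij jl) -jlE jb eqxx b1.
- have [[/and3P[li /eqP la a0] _ _ _]|[_ _ _ ->]|->] := dirP l; last 2 first.
  + by rewrite jE ltW.
  + by rewrite jE.
  have := dl_gt0; rewrite -oppr_lt0 -jE /spread_dir.
  by rewrite /toleft (leq_ltn_trans jl li) jlE la eqxx a0 /= ltxx.
Unshelve. all: by end_near. Qed.

Lemma spread_itv : \forall e \near 0^'+, forall j, 0 <= spread e j <= 1.
Proof.
apply: filter_forall => j; have w01 := tnth_itv j sw.
have [[_ wa a0 dE]|[_ wb b1 dE]|dE] := dirP j.
- rewrite wa in w01; near=> e; have e0 : 0 < e by near: e; exact: nbhs_right_gt.
  have h : e * dl < a by near: e; exact: near_right0_mul_lt.
  have := mulr_gt0 e0 dl_gt0.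
  by rewrite /spread dE wa; lra.
- rewrite wb in w01; near=> e; have e0 : 0 < e by near: e; exact: nbhs_right_gt.
  have h : e * dr < 1 - b by near: e; apply: near_right0_mul_lt; lra.
  have := mulr_gt0 e0 dr_gt0.
  by rewrite /spread dE wb; lra.
- by apply: nearW => e; rewrite /spread dE mulr0 addr0.
Unshelve. all: by end_near. Qed.

Let spread_neq e j : 0 < e -> (spread e j != tnth w j) = (spread_dir j != 0).
Proof. by move=> e0; rewrite /spread -subr_eq0 addrAC subrr add0r mulf_eq0 (gt_eqF e0). Qed.

(** Undo the perturbation: seen from [t < a], both clusters return towards [a], with nonnegative
    weighted displacement by [dir_sum_le0]. The bound on [e * dl] keeps the left cluster to the
    right of [t]. *)
Lemma spread_lt_leftward e t : 0 < e -> (forall j, 0 <= spread e j <= 1) ->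
  0 <= t -> t < a -> e * dl <= a - t -> F (spread e) t != -oo%E ->
  (F (spread e) t < F (tnth w) t)%E.
Proof.
move=> e0 e01 t0 ta edl Fe; have a0 : 0 < a by exact: le_lt_trans ta.
have /andP[_ a1] := node_itv sw (leqW iN).
have t01 : 0 <= t <= 1 by rewrite -/a in a1; lra.
apply: (@translate_sum_lt_right _ _ _ nu_gt0 _ _ _ _ _ a (fun j => spread_dir j != 0)) => //.
- exact: J_neq_pinfty.
- by move=> j; exact: dist_le1.
- by move=> j; apply: dist_le1 => //; exact: tnth_itv.
- by rewrite -/a in a1; lra.
- move=> j /negPn/eqP dE; rewrite /spread dE mulr0 addr0 lexx andbT /=.
  exact: le_total.
- move=> j dj; have [[_ wa _ dE]|[_ wb _ dE]|dE] := dirP j; last by rewrite dE eqxx in dj.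
  + have := mulr_gt0 e0 dl_gt0; rewrite /spread dE wa => h.
    by split; try lra; apply/orP; left; lra.
  + have := mulr_gt0 e0 dr_gt0; rewrite /spread dE wb => h; have := ab => ab'.
    by split; try lra; apply/orP; right; lra.
- rewrite (_ : \sum_(j | _) _ = - (e * \sum_(j | spread_dir j != 0) nu j * spread_dir j)).
    by rewrite oppr_ge0 pmulr_rle0// dir_sum_le0.
  rewrite mulr_sumr -sumrN; apply: eq_bigr => j _; rewrite /spread; ring.
- have [j jl] := aE a0; exists j; rewrite spread_neq// dirE jl (left_not_right jl).
  by rewrite addr0 oppr_eq0 gt_eqF.
Qed.

Lemma spread_lt_rightward e t : 0 < e -> (forall j, 0 <= spread e j <= 1) ->
  t <= 1 -> b < t -> e * dr <= t - b -> F (spread e) t != -oo%E ->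
  (F (spread e) t < F (tnth w) t)%E.
Proof.
move=> e0 e01 t1 bt edr Fe; have b1 : b < 1 by exact: lt_le_trans t1.
have /andP[b0 _] := node_itv sw (iN : (i.+1 <= n.+1)%N).
have t01 : 0 <= t <= 1 by rewrite -/b in b0; lra.
apply: (@translate_sum_lt_left _ _ _ nu_gt0 _ _ _ _ _ b (fun j => spread_dir j != 0)) => //.
- exact: J_neq_pinfty.
- by move=> j; exact: dist_le1.
- by move=> j; apply: dist_le1 => //; exact: tnth_itv.
- by rewrite -/b in b0; lra.
- move=> j /negPn/eqP dE; rewrite /spread dE mulr0 addr0 lexx andbT /=.
  exact: le_total.
- move=> j dj; have [[_ wa _ dE]|[_ wb _ dE]|dE] := dirP j; last by rewrite dE eqxx in dj.
  + have := mulr_gt0 e0 dl_gt0; rewrite /spread dE wa => h; have := ab => ab'.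
    by split; try lra; apply/orP; right; lra.
  + have := mulr_gt0 e0 dr_gt0; rewrite /spread dE wb => h.
    by split; try lra; apply/orP; left; lra.
- rewrite (_ : \sum_(j | _) _ = e * \sum_(j | spread_dir j != 0) nu j * spread_dir j).
    by rewrite pmulr_rge0// dir_sum_ge0.
  rewrite mulr_sumr; apply: eq_bigr => j _; rewrite /spread; ring.
- have [j jr] := bE b1; exists j; rewrite spread_neq// dirE jr.
  case: ifPn => [/left_not_right|_]; first by rewrite jr.
  by rewrite add0r gt_eqF.
Qed.

(* Covering [0,1]: near the [i]-th interval semicontinuity applies, elsewhere the
   balanced move strictly lowers the sum. *)
Lemma spread_lt_total : (interval_sup w i < total_sup (tnth w))%E ->
  \forall e \near 0^'+, forall t, 0 <= t <= 1 ->
    (F (spread e) t < total_sup (tnth w))%E.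
Proof.
set M := total_sup _ => miM.
have Ft_le t : 0 <= t <= 1 -> (F (tnth w) t <= M)%E.
  by move=> t01; apply: ereal_sup_ubound; exists t => //=; rewrite in_itv.
have MNy : (-oo < M)%E by exact: le_lt_trans (leNye _) miM.
have lt_of e t : (F (spread e) t != -oo%E -> (F (spread e) t < M)%E) -> (F (spread e) t < M)%E.
  by case: (eqVneq (F (spread e) t) -oo%E) => [-> //|_]; apply.
have /compact_near_coveringP/near_covering_withinP cov := @segment_compact R 0 1.
have FR : Filter (0 : R)^'+ by exact: within_filter.
have := cov R 0^'+ (fun e t => (F (spread e) t < M)%E) FR.
suff H : forall x : R, `[0, 1]%classic x ->
    \forall x' \near x & e \near 0^'+, `[0, 1]%classic x' -> (F (spread e) x' < M)%E.
  by move=> /(_ H); apply: filterS => e He t t01; apply: He; rewrite /= in_itv.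
move=> t; rewrite /= in_itv/= => t01.
have [ta|at_] := ltP t a.
  near=> t' e => /=; rewrite in_itv/= => t'01; have e0 : 0 < e by near: e; exact: nbhs_right_gt.
  (* Half of the gap [a - t] is left for the motion of [t'] and half for the displacement of the
     left cluster. *)
  have t'a : t' < (t + a) / 2 by near: t'; apply: lt_nbhsl; lra.
  have ed : e * dl < (a - t) / 2 by near: e; apply: near_right0_mul_lt; lra.
  apply: lt_of => Fe; apply: lt_le_trans (Ft_le _ t'01).
  by apply: spread_lt_leftward => //; [near: e; exact: spread_itv|lra|lra|lra].
have [bt|tb] := ltP b t.
  near=> t' e => /=; rewrite in_itv/= => t'01; have e0 : 0 < e by near: e; exact: nbhs_right_gt.
  have t'b : (t + b) / 2 < t' by near: t'; apply: lt_nbhsr; lra.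
  have ed : e * dr < (t - b) / 2 by near: e; apply: near_right0_mul_lt; lra.
  apply: lt_of => Fe; apply: lt_le_trans (Ft_le _ t'01).
  by apply: spread_lt_rightward => //; [near: e; exact: spread_itv|lra|lra|lra].
have FtM : (F (tnth w) t < M)%E.
  apply: le_lt_trans miM; apply: ereal_sup_ubound; exists t => //=.
  by rewrite in_itv/= at_ tb.
have [c Ftc cM] : exists2 c : R, (F (tnth w) t < c%:E)%E & (c%:E <= M)%E.
  move: FtM; case: (F _ _) => [r| |]//; case: (M) => [s| |]//; rewrite ?lte_fin.
  - by move=> rs; exists s.
  - by move=> _; exists (r + 1); rewrite ?leey// lte_fin ltrDl.
  - by move=> _; exists s; rewrite ?ltNyr.
  - by move=> _; exists 0; rewrite ?ltNyr ?leey.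
pose G : set_system (R * R) := filter_prod (within `[0, 1]%classic (nbhs t)) 0^'+.
have : \forall p \near G, (F (spread p.2) p.1 < c%:E)%E.
  apply: (@translate_sum_usc_along _ G _ (fun p => spread p.2) fst (tnth w) t _ _ _ _ t01 _ c Ftc).
  - move=> j; rewrite /spread -[X in _ --> X]addr0 -[X in _ --> _ + X](mul0r (spread_dir j)).
    apply: cvgD; first exact: cvg_cst.
    apply: cvgMl; apply: cvg_trans (_ : 0^'+ --> _).
      exact: cvg_snd.
    exact: cvg_within.
  - apply: cvg_trans (_ : within `[0, 1]%classic (nbhs t) --> _); first exact: cvg_fst.
    exact: cvg_within.
  - exists (`[0, 1]%classic, setT); last by case=> x y /= []; rewrite in_itv.
    by split => /=; [exact: withinT|exact: filterT].
  - exists (setT, [set e | forall j, 0 <= spread e j <= 1]); last by case=> x y /= [].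
    by split => /=; [exact: filterT|exact: spread_itv].
  - by move=> j; exact: tnth_itv.
case=> -[A B] /= [hA hB] sub.
exists ([set x | `[0, 1]%classic x -> A x], B); first by split.
case=> x e /= [Ax Be] x01; apply: lt_le_trans cM.
by apply: (sub (x, e)); split => //; exact: Ax.
Unshelve. all: by end_near. Qed.

End Perturbation.

Lemma exists_equioscillation : exists2 w : n.-tuple R, node_system w &
  forall i, (i <= n)%N -> interval_sup w i = total_sup (tnth w).
Proof.
have [w sw wmin] := exists_total_sup_min.
exists w => // i iN; apply/eqP; rewrite eq_le; apply/andP; split.
  apply: le_ereal_sup => _ [t /= + <-]; rewrite in_itv/= => /andP[t0 t1]; exists t => //=.
  have /andP[a0 _] := node_itv sw (leqW iN).
  have /andP[_ b1] := node_itv sw (iN : (i.+1 <= n.+1)%N).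
  by rewrite in_itv/=; lra.
rewrite leNgt; apply/negP => miM.
have [e [le_e e01 Fe]] : exists e, [/\ forall j l : 'I_n, (j <= l)%N -> spread w i e j <= spread w i e l,
    forall j, 0 <= spread w i e j <= 1 &
    forall t, 0 <= t <= 1 -> (F (spread w i e) t < total_sup (tnth w))%E].
  apply: (@filter_ex _ (0 : R)^'+); near=> e; split.
  - by near: e; exact: spread_ordered.
  - by near: e; exact: spread_itv.
  - by near: e; exact: spread_lt_total.
have := wmin _ (node_system_tuple e01 le_e); rewrite leNgt => /negP; apply.
have -> : tnth [tuple spread w i e j | j < n] = spread w i e.
  by apply/funext => j; rewrite tnth_mktuple.
(* The new global supremum is attained, so the pointwise strict bound [Fe] makes it smaller than the
   minimum. *)
have [t] := translate_sum_argmax (lexx 0) ler01 (lexx 1) e01.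
by rewrite in_itv/= => t01; rewrite /total_sup => ->; exact: Fe.
Unshelve. all: by end_near. Qed.

End Maxima.

(** * Finite values at equioscillation points, and the theorem *)

Lemma field_function_escapes (R : realType) n (J : R -> \bar R) (s : n.-tuple R) :
  field_function n J ->
  exists2 t, 0 <= t <= 1 & J t != -oo%E /\ t \notin s.
Proof.
move=> [_ nD]; apply: contrapT => H; move: nD; apply/negP; rewrite -leNgt.
(* If all finite values of [J] sat on the [n] entries of [s], the weighted count would be at most
   [n], as each weight is at most 1. *)
have Ds : finite_domain J `<=` [set` s].
  move=> t [t01 Jt] /=; apply/negPn/negP => ts; apply: H; exists t => //.
have fs : finite_set [set` s] by exact: finite_seq.
have f1 : finite_set (finite_domain J `&` `]0%R, 1%R[).
  by apply: sub_finite_set fs; exact: subIset (or_introl Ds).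
have f2 : finite_set (finite_domain J `&` [set 0%R; 1%R]).
  by apply: sub_finite_set fs; exact: subIset (or_introl Ds).
rewrite /counting !asboolT//.
set A := fset_set _; set B := fset_set _.
have cAB : (#|` A| + #|` B| <= n)%N.
  have dAB : [disjoint A & B]%fset.
    apply/fdisjointP => t; rewrite !in_fset_set// => /set_mem[_ /=].
    rewrite in_itv/= => /andP[t0 t1]; apply/negP => /set_mem[_ [tE|tE]].
      by rewrite tE ltxx in t0.
    by rewrite tE ltxx in t1.
  have -> : (#|` A| + #|` B| = #|` A `|` B|%fset)%N.
    by rewrite cardfsU (eqP dAB) cardfs0 subn0.
  have : (A `|` B `<=` seq_fset tt s)%fset.
    apply/fsubsetP => t; rewrite in_fsetU seq_fsetE.
    by rewrite !in_fset_set// => /orP[] /set_mem[/Ds].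
  move=> /fsubset_leq_card /leq_trans; apply.
  by rewrite size_seq_fset -[leqRHS](size_tuple s) size_undup.
rewrite -EFinM -EFinD lee_fin; apply: (@le_trans _ _ (#|` A|%:R + #|` B|%:R)).
  by rewrite lerD2l ler_piMl//; lra.
by rewrite -natrD ler_nat.
Qed.

Section Field.
Context {R : realType} {n : nat} (nu : 'I_n -> R) (k J : R -> \bar R).
Hypothesis kk : two_sided_kernel k.

Lemma translate_sum_neq_ninfty y t : node_system y -> 0 <= t <= 1 -> J t != -oo%E ->
  t \notin (y : seq R) -> (forall j, 0 < nu j) ->
  translate_sum nu k J (tnth y) t != -oo%E.
Proof.
move=> sy t01 Jt ty nu0; rewrite /translate_sum adde_eq_ninfty negb_or Jt/=.
elim/big_ind : _ => [//|u v|j _]; first by rewrite adde_eq_ninfty negb_or => -> ->.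
have y01 := tnth_itv j sy.
have : k (t - tnth y j) != -oo%E.
  apply: contraNneq ty => /(two_sided_ninfty kk) H.
  have -> : t = tnth y j by apply/eqP; rewrite -subr_eq0 H//; lra.
  exact: mem_tnth.
by case: (k _) => [r| |]// _; rewrite gt0_muley ?lte_fin.
Qed.

End Field.

Theorem theorem1p2 (R : realType) (n : nat) (hn : (1 <= n <= 3)%N)
    (nu : 'I_n -> R) (hnu : forall j : 'I_n, 0 < nu j)
    (K : R -> R) (hK : kernel_function K)
    (hKconc : strictly_concave_kernel K)
    (hKmono : strictly_monotone_kernel K)
    (J : R -> \bar R) (hJ : field_function n J)
    (hJusc : usc_unit_interval J) :
  (forall x y : n.-tuple R,
     regular_node_system nu K J x -> regular_node_system nu K J y -> x <> y ->
     exists i j : 'I_n.+1,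
       (interval_max nu K J y i < interval_max nu K J x i)%E /\
       (interval_max nu K J x j < interval_max nu K J y j)%E) /\
  (exists! w : n.-tuple R, equioscillation_point nu K J w).
Proof.
have kk := two_sided_kernel_ext hK hKconc hKmono.
have J_fin t : 0 <= t <= 1 -> J t != +oo%E.
  case: hJ => -[M JM] _ t01; have := JM t; rewrite in_itv/= => /(_ t01).
  by apply: contraTneq => ->; rewrite leye_eq.
have J_usc t : 0 <= t <= 1 -> forall a : R, (J t < a%:E)%E ->
    \forall s \near t, 0 <= s <= 1 -> (J s < a%:E)%E.
  move=> t01 a Ja; have [|V] := hJusc t (- a); first by rewrite EFinN lteN2.
  have tI : `[0, 1]%classic t by rewrite /= in_itv.
  (* A neighbourhood in the subspace topology is one in [R] restricted to the unit interval. *)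
  move=> nV VJ; have {}nV : \forall s \near t, `[0, 1]%classic s -> V s.
    have : within `[0, 1]%classic (nbhs t) V by rewrite (nbhs_subspace_in tI); exact: nV.
    by [].
  by apply: filterS nV => s sV s01; rewrite -lteN2 -EFinN; apply/VJ/sV; rewrite /= in_itv.
have ieE (y : n.-tuple R) (i : 'I_n.+1) : interval_max nu K J y i = interval_sup nu (kernel_ext K) J y i.
  by [].
have tw x y : regular_node_system nu K J x -> regular_node_system nu K J y -> x <> y ->
     exists i j : 'I_n.+1,
       (interval_max nu K J y i < interval_max nu K J x i)%E /\
       (interval_max nu K J x j < interval_max nu K J y j)%E.
  move=> [sx mx] [sy my] xy.
  have [||i [j [iN jN h1 h2]]] := intertwining hnu kk J_fin J_usc hn sx sy _ _ xy.
  - by move=> i iN; exact: (mx (Ordinal (iN : (i < n.+1)%N))).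
  - by move=> i iN; exact: (my (Ordinal (iN : (i < n.+1)%N))).
  by exists (Ordinal (iN : (i < n.+1)%N)), (Ordinal (jN : (j < n.+1)%N)).
(* A single point with a finite value makes one interval maximum finite, hence all of them, since
   they are equal; intertwining then applies to equioscillation points. *)
have reg w : equioscillation_point nu K J w -> regular_node_system nu K J w.
  move=> [sw ew]; split => // j.
  have [t t01 [Jt tw']] := field_function_escapes w hJ.
  have [i ti] := exists_node_itv sw t01; rewrite (ew j i) -ltNye.
  apply: lt_le_trans (_ : (translate_sum nu (kernel_ext K) J (tnth w) t <= _)%E).
    by rewrite ltNye translate_sum_neq_ninfty.
  by apply: ereal_sup_ubound; exists t.
split=> //; have [w sw we] := exists_equioscillation hnu kk J_fin J_usc.
have ew : equioscillation_point nu K J w.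
  by split=> // i j; rewrite !ieE !we// -ltnS.
exists w; split => // w' ew'; apply: contrapT => ww'.
have [i [j [h1 h2]]] := tw _ _ (reg _ ew) (reg _ ew') ww'.
by move: h2; rewrite (ew.2 j i) (ew'.2 j i) => /(lt_trans h1); rewrite ltxx.
Qed.
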